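(* Let $r,k$ be integers with $0\le k<r$, and consider the functional $$J_{r,k}(f)=\frac{\Vert f^{(r)}\Vert_{L_2[-1,1]}}{\Vert f^{(k)}\Vert_{L_\infty[-1,1]}},\qquad f\in \mathring{W}_2^r(-1,1),\ f\not\equiv 0 .$$ 1. If $k$ is odd, then for all $r>k$ the extremal in the minimization problem $\lambda(r,k,2,\infty)=\min_f J_{r,k}(f)$ is asymmetrical (i.e. every minimizer is neither an even nor an odd function). 2. If $k$ is even, then for all $r>k$ an even function provides a local minimum to the functional $J_{r,k}$ (i.e. there is a nonzero even function $f_0\in \mathring{W}_2^r(-1,1)$ that is a local minimizer of $J_{r,k}$).
   Context: $\mathring{W}_2^r(-1,1)$ denotes the space of real functions $f$ on $[-1,1]$ such that $f,f',\dots,f^{(r-1)}$ are absolutely continuous on $[-1,1]$, $f^{(r)}\in L_2(-1,1)$, and $f^{(j)}(\pm1)=0$ for $j=0,1,\dots,r-1$. It is normed by $\Vert f^{(r)}\Vert_{L_2[-1,1]}$, and ''local'' refers to this norm. An extremal is a nonzero function in $\mathring{W}_2^r(-1,1)$ at which the minimum $\lambda(r,k,2,\infty)$ of $J_{r,k}$ is attained. ''Even'' and ''odd'' refer to the reflection $x\mapsto -x$ of $[-1,1]$; an extremal is called asymmetrical if it is neither even nor odd. The integer $k=0$ counts as even. *)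

(* Defs.v *)
From HB Require Import structures.
From mathcomp Require Import all_boot all_order all_algebra.
From mathcomp Require Import all_classical all_reals all_analysis.

Set Implicit Arguments.
Unset Strict Implicit.
Unset Printing Implicit Defensive.

Import Order.TTheory GRing.Theory Num.Theory.
Import numFieldNormedType.Exports.
Local Open Scope ring_scope.
Local Open Scope classical_set_scope.

(* The intervals ]u i, v i[ may be degenerate (u i = v i): such an interval is
   empty and contributes 0 to both sums. *)
Definition absolutely_continuous {R : realType} (a b : R) (f : R -> R) : Prop :=
  forall e : R, 0 < e -> exists2 d : R, 0 < d &
    forall (n : nat) (u v : 'I_n -> R),
      (forall i, a <= u i /\ u i <= v i /\ v i <= b) ->
      trivIset [set: 'I_n] (fun i => `]u i, v i[) ->
      \sum_(i < n) (v i - u i) < d ->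
      \sum_(i < n) `|f (v i) - f (u i)| < e.

Definition mu11 (R : realType) : {measure set (measurableTypeR R) -> \bar R} :=
  mrestr (@lebesgue_measure R) (measurable_itv `[-1 : R, 1]%R).

(* A function on [-1, 1] is represented by its extension by 0 to the whole
   line; it is thereby determined by its values on [-1, 1].  Because f and its
   derivatives of order < r vanish at -1 and 1, the two-sided derivatives of
   orders 1, ..., r - 1 of the extension at -1 and 1 exist and are equal to the
   one-sided derivatives of f.  Conversely, if the one-sided derivative of order
   j.+1 < r of f at an end point were nonzero, the extension of f^`(j) would
   not be derivable there, so the encoding adds no function.  The function
   f^`(r) is the almost everywhere defined derivative of f^`(r.-1): [derive1]
   takes a default value at the points where the derivative does not exist. *)
Definition sobolev0 {R : realType} (r : nat) (f : R -> R) : Prop :=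
  [/\ (forall x : R, ~~ (-1 <= x <= 1) -> f x = 0),
      (forall j, (j.+1 < r)%N ->
        forall x : R, -1 <= x <= 1 -> derivable f^`(j) x 1),
      (forall j, (j < r)%N -> absolutely_continuous (-1) 1 f^`(j)),
      f^`(r) \in Lfun (mu11 R) 2%:E
    & (forall j, (j < r)%N -> f^`(j) (-1) = 0 /\ f^`(j) 1 = 0)].

Definition sobolev0_norm {R : realType} (r : nat) (f : R -> R) : R :=
  fine ('N[mu11 R]_2%:E [EFin \o f^`(r)])%E.

(* For f in [sobolev0 r] and k < r both norms are finite; the second one is
   positive when f is nonzero. *)
Definition J {R : realType} (r k : nat) (f : R -> R) : R :=
  sobolev0_norm r f / fine ('N[mu11 R]_+oo [EFin \o f^`(k)])%E.

Definition admissible {R : realType} (r : nat) (f : R -> R) : Prop :=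
  sobolev0 r f /\ f <> cst 0.

Definition extremal {R : realType} (r k : nat) (f : R -> R) : Prop :=
  admissible r f /\ forall g : R -> R, admissible r g -> J r k f <= J r k g.

Definition local_minimizer {R : realType} (r k : nat) (f : R -> R) : Prop :=
  admissible r f /\
  exists2 e : R, 0 < e & forall g : R -> R, admissible r g ->
    sobolev0_norm r (g \- f) < e -> J r k f <= J r k g.

Definition even_on11 {R : realType} (f : R -> R) : Prop :=
  forall x : R, -1 <= x <= 1 -> f (- x) = f x.

Definition odd_on11 {R : realType} (f : R -> R) : Prop :=
  forall x : R, -1 <= x <= 1 -> f (- x) = - f x.

Definition asymmetrical {R : realType} (f : R -> R) : Prop :=
  ~ even_on11 f /\ ~ odd_on11 f.

(* Main.v *)
Require Import Defs.
From HB Require Import structures.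
From mathcomp Require Import all_boot all_order all_algebra.
From mathcomp Require Import all_classical all_reals all_analysis.
From mathcomp Require Import measurable_realfun ess_sup_inf.
From mathcomp Require Import ring lra zify.

(** Write r = s + k + 1 and V_n = (X^2 - 1)^n / (2^n n!).

    For -1 < x < 1 the linear form f |-> f^(k)(x) is represented, in the inner
    product of the derivatives of order r, by a spline g_x of the space: two
    polynomials that meet at x, and whose derivative of order r is the
    truncated power (x - t)_+^s / s! minus its orthogonal projection on the
    polynomials of degree < r [green_pieces, green_representation].  By
    Cauchy-Schwarz, f^(k)(x)^2 <= N(x) |f|^2 with N(x) = |g_x|^2 = g_x^(k)(x),
    and g_x realizes equality.  Minimizing J amounts to maximizing N.

    In the basis of the Legendre polynomials L_n = V_n^(n) the identity
    (2n + 1) L_n = L_(n+1)' - L_(n-1)' makes the sum that computes N'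
    telescope: N' = - V_r^(k+1) V_(r-1)^(k) [deriv_extremal_value].  Since
    V_r' = X V_(r-1), this is N' = - (X u^2 + k u w) with w = V_(r-1)^(k-1) and
    u = w' = V_(r-1)^(k).

    - For k even, N + (k / 2) w^2 has the derivative - X u^2, so that it is
      largest at 0; as w vanishes at 0, N is largest at 0 too
      [extremal_value_le_at0].  The representer at 0, made even by
      symmetrization, is therefore a global minimizer of J.

    - For k odd, N'(0) = 0 < N''(0), so 0 does not maximize N
      [extremal_value_gt_at0].  Let f be extremal, and let |f^(k)| be largest
      at x0; then x0 maximizes N, so x0 <> 0.  If f were even or odd, |f^(k)|
      would also be largest at -x0, and the equality case of Cauchy-Schwarz
      would make f^(r) proportional to the derivatives of order r of both
      representers.  Then T^(k)(x0) and T^(k)(-x0) would vanish together for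
      every T in the space, which a polynomial T disproves
      [separating_function].

    The representation of f^(k)(x) rests on the fundamental theorem of calculus
    for absolutely continuous functions [ac_derivable_ae, ac_FTC]: such a
    function is the difference of two nondecreasing absolutely continuous
    ones, the Lebesgue-Stieltjes measures of these have densities by the
    Radon-Nikodym theorem, and the Lebesgue differentiation theorem identifies
    the densities with derivatives. *)

Set Implicit Arguments.
Unset Strict Implicit.
Unset Printing Implicit Defensive.

Import Order.TTheory GRing.Theory Num.Theory.
Local Open Scope ring_scope.

(** * Integration of polynomials *)

Section PolyIntegration.
Context {R : realFieldType}.
Implicit Types (p q : {poly R}) (a b c : R).

Lemma deriv0_const p a : p^`() = 0 -> p = p.[a]%:P.
Proof.
move=> p0; have [c ->] : exists c, p = c%:P; last by rewrite hornerC.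
exists p`_0; apply/polyP => -[|i]; rewrite coefC//=.
have := coef_deriv p i; rewrite p0 coef0 => /esym/eqP.
by rewrite -mulr_natr mulf_eq0 pnatr_eq0 orbF => /eqP.
Qed.

Definition antideriv a p : {poly R} :=
  let P := \poly_(i < (size p).+1) (p`_i.-1 / i%:R) in P - P.[a]%:P.

Lemma antiderivK a p : (antideriv a p)^`() = p.
Proof.
rewrite /antideriv derivB derivC subr0; apply/polyP => i.
rewrite coef_deriv coef_poly /= ltnS.
case: ltnP => [_|/leq_sizeP->//]; last by rewrite mul0rn.
by rewrite -[LHS]mulr_natr divfK// pnatr_eq0.
Qed.

Lemma antideriv_at a p : (antideriv a p).[a] = 0.
Proof. by rewrite /antideriv hornerD hornerN hornerC subrr. Qed.

Lemma antideriv_unique a p q : q^`() = p -> q.[a] = 0 -> antideriv a p = q.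
Proof.
move=> qp qa; apply/eqP; rewrite -subr_eq0; apply/eqP.
have d0 : (antideriv a p - q)^`() = 0 by rewrite derivB antiderivK qp subrr.
by rewrite (deriv0_const a d0) hornerD hornerN antideriv_at qa subrr.
Qed.

Lemma antideriv_is_linear a : linear (antideriv a).
Proof.
move=> c p q; apply: antideriv_unique.
  by rewrite derivD derivZ !antiderivK.
by rewrite hornerD hornerZ !antideriv_at mulr0 addr0.
Qed.

HB.instance Definition _ a := GRing.isLinear.Build R {poly R} {poly R} _
  (antideriv a) (antideriv_is_linear a).

Lemma iter_antiderivZ a n c p :
  iter n (antideriv a) (c *: p) = c *: iter n (antideriv a) p.
Proof. by elim: n => //= n ->; rewrite linearZ. Qed.

Lemma iter_antiderivB a n p q :
  iter n (antideriv a) (p - q) = iter n (antideriv a) p - iter n (antideriv a) q.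
Proof. by elim: n => //= n ->; rewrite linearB. Qed.

Lemma iter_antiderivD a n p q :
  iter n (antideriv a) (p + q) = iter n (antideriv a) p + iter n (antideriv a) q.
Proof. by elim: n => //= n ->; rewrite linearD. Qed.

Lemma derivn_iter_antideriv a i j p :
  (iter (i + j) (antideriv a) p)^`(i) = iter j (antideriv a) p.
Proof. by elim: i => [|i IH]; rewrite ?derivn0// derivSn addSn /= antiderivK. Qed.

Definition polyint a b p : R := (antideriv a p).[b].

Lemma polyint_deriv a b p : polyint a b p^`() = p.[b] - p.[a].
Proof.
rewrite /polyint (@antideriv_unique a _ (p - p.[a]%:P)) ?derivB ?derivC ?subr0//.
  by rewrite hornerD hornerN hornerC.
by rewrite hornerD hornerN hornerC subrr.
Qed.

Lemma polyintD a b p q : polyint a b (p + q) = polyint a b p + polyint a b q.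
Proof. by rewrite /polyint linearD hornerD. Qed.

Lemma polyintB a b p q : polyint a b (p - q) = polyint a b p - polyint a b q.
Proof. by rewrite /polyint linearB hornerD hornerN. Qed.

Lemma polyintZ a b c p : polyint a b (c *: p) = c * polyint a b p.
Proof. by rewrite /polyint linearZ hornerZ. Qed.

Lemma polyint0 a b : polyint a b 0 = 0.
Proof. by rewrite /polyint linear0 horner0. Qed.

Lemma polyint_sum a b n (F : 'I_n -> {poly R}) :
  polyint a b (\sum_i F i) = \sum_i polyint a b (F i).
Proof. by rewrite /polyint linear_sum horner_sum. Qed.

Lemma polyint_chasles a b c p : polyint a b p + polyint b c p = polyint a c p.
Proof.
by rewrite -[p](antiderivK a) !polyint_deriv; ring.
Qed.

Lemma polyint_by_parts a b p q : polyint a b (p^`() * q) =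
  p.[b] * q.[b] - p.[a] * q.[a] - polyint a b (p * q^`()).
Proof. by rewrite -!hornerM -polyint_deriv derivM polyintD addrK. Qed.

(** The kernel of the integral form of Taylor's remainder; it is a polynomial in
    the integration variable. *)
Definition taylor_ker b i : {poly R} := (i`!%:R)^-1 *: (b%:P - 'X) ^+ i.

Lemma taylor_ker0 b : taylor_ker b 0 = 1.
Proof. by rewrite /taylor_ker fact0 invr1 scale1r expr0. Qed.

Lemma deriv_taylor_ker b i : (taylor_ker b i.+1)^`() = - taylor_ker b i.
Proof.
rewrite /taylor_ker derivZ deriv_exp derivB derivC derivX sub0r mulN1r /=.
rewrite mulNrn scalerN -scaler_nat scalerA; congr (- (_ *: _)).
by rewrite factS natrM invfM mulrAC mulVf ?mul1r// pnatr_eq0.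
Qed.

Lemma taylor_ker_at b i : (taylor_ker b i.+1).[b] = 0.
Proof. by rewrite /taylor_ker !hornerE subrr expr0n mulr0. Qed.

(** Cauchy's formula: integrating against the kernel is iterated integration.
    The index j makes the induction go through. *)
Lemma polyint_taylor_ker a b i j p :
  polyint a b (iter j (antideriv a) p * taylor_ker b i) = (iter (i + j).+1 (antideriv a) p).[b].
Proof.
elim: i j => [|i IH] j; first by rewrite taylor_ker0 mulr1.
rewrite -[X in polyint _ _ (X * _)](antiderivK a) -iterS polyint_by_parts.
rewrite taylor_ker_at mulr0 iterS antideriv_at mul0r subrr sub0r deriv_taylor_ker.
by rewrite mulrN -scaleN1r polyintZ mulN1r opprK -iterS IH addnS.
Qed.

Lemma iter_antideriv_taylor_ker b n s :
  iter n (antideriv b) (taylor_ker b s) = (-1) ^+ n *: taylor_ker b (s + n).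
Proof.
elim: n => [|n IH]; first by rewrite expr0 scale1r addn0.
rewrite iterS; apply: antideriv_unique; last by rewrite addnS hornerZ taylor_ker_at mulr0.
by rewrite addnS derivZ deriv_taylor_ker exprS mulN1r scaleNr scalerN opprK IH.
Qed.

Lemma size_taylor_ker b i : (size (taylor_ker b i) <= i.+1)%N.
Proof.
rewrite /taylor_ker (leq_trans (size_scale_leq _ _))// (leq_trans (size_poly_exp_leq _ _))//.
have -> : (size (b%:P - 'X : {poly R})).-1 = 1%N.
  by rewrite -opprB size_polyN size_XsubC.
by rewrite mul1n.
Qed.

(** The derivative of (X - a)^(n+1) q has again the form (X - a)^n q', which gives
    an induction over all q.  The
    first part gives boundary conditions, the second one the value L_n(1) and a
    nonzero value of a test function. *)
Lemma derivn_XsubC_exp a n q :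
  (forall j, (j < n)%N -> ((('X - a%:P) ^+ n * q)^`(j)).[a] = 0) /\
  ((('X - a%:P) ^+ n * q)^`(n)).[a] = n`!%:R * q.[a].
Proof.
elim: n q => [|n IH] q; first by split=> //; rewrite expr0 mul1r derivn0 fact0 mul1r.
have dE : (('X - a%:P) ^+ n.+1 * q)^`() =
    ('X - a%:P) ^+ n * (n.+1%:R *: q + ('X - a%:P) * q^`()).
  rewrite derivM deriv_exp derivB derivX derivC subr0 mul1r /= mulrDr mulrA -exprSr.
  by rewrite -scaler_nat -scalerAl -scalerAr.
have [IH1 IH2] := IH (n.+1%:R *: q + ('X - a%:P) * q^`()).
split=> [[_|j]|]; last 2 first.
- by rewrite ltnS derivSn dE; exact: IH1.
- rewrite derivSn dE IH2 !hornerE subrr mul0r addr0 factS natrM; ring.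
- by rewrite derivn0 exprS !hornerE subrr !mul0r.
Qed.
End PolyIntegration.

(** * Legendre polynomials *)

Section Legendre.
Context {R : realFieldType}.
Implicit Types (p q : {poly R}) (x : R).

Let W : {poly R} := 'X^2 - 1.

Definition rodrigues n : {poly R} := ((2 ^ n * n`!)%:R)^-1 *: ('X^2 - 1) ^+ n.

Definition legendre n : {poly R} := (rodrigues n)^`(n).

Lemma rodrigues_const_neq0 n : (2 ^ n * n`!)%:R != 0 :> R.
Proof. by rewrite pnatr_eq0 muln_eq0 expn_eq0 /= -lt0n fact_gt0. Qed.

Lemma rodrigues0 : rodrigues 0 = 1.
Proof. by rewrite /rodrigues expn0 fact0 invr1 scale1r expr0. Qed.

Lemma rodriguesS n : (2 * n.+1)%:R *: rodrigues n.+1 = W * rodrigues n.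
Proof.
rewrite /rodrigues scalerA -scalerAr -exprS; congr (_ *: _).
have -> : (2 ^ n.+1 * (n.+1)`! = 2 * n.+1 * (2 ^ n * n`!))%N by rewrite expnS factS; ring.
by rewrite (natrM _ (2 * n.+1)) invfM mulrA mulfV ?mul1r.
Qed.

Lemma deriv_rodrigues n : (rodrigues n.+1)^`() = 'X * rodrigues n.
Proof.
have W' : W^`() = 2%:R *: 'X by rewrite derivB derivXn -polyC1 derivC subr0 scaler_nat.
rewrite /rodrigues derivZ deriv_exp W' /= -scaler_nat -scalerAl !scalerA -scalerAr.
congr (_ *: _).
have -> : (2 ^ n.+1 * (n.+1)`! = 2 * n.+1 * (2 ^ n * n`!))%N by rewrite expnS factS; ring.
rewrite (natrM _ (2 * n.+1)) invfM -mulrA -natrM [(n.+1 * 2)%N]mulnC.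
by rewrite mulrAC mulVf ?mul1r.
Qed.

(** The source of the three-term relation for the derivatives of the Legendre
    polynomials: it follows from V_(n+1)' = X V_n and X^2 = (X^2 - 1) + 1. *)
Lemma deriv2_rodrigues n :
  (rodrigues n.+2)^`(2) = (2 * n + 3)%:R *: rodrigues n.+1 + rodrigues n.
Proof.
rewrite derivSn derivn1 deriv_rodrigues derivM derivX mul1r deriv_rodrigues.
have -> : 'X * ('X * rodrigues n) = W * rodrigues n + rodrigues n.
  by rewrite /W; ring.
rewrite -rodriguesS addrA -[X in X + _ + _]scale1r -scalerDl; congr (_ *: _ + _).
by rewrite nat1r; congr (_%:R); lia.
Qed.

Lemma rodrigues_factor1 n :
  rodrigues n = ('X - 1%:P) ^+ n * (((2 ^ n * n`!)%:R)^-1 *: ('X + 1) ^+ n).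
Proof.
rewrite /rodrigues -scalerAr -exprMn; congr (_ *: _ ^+ _).
by rewrite polyC1; ring.
Qed.

Lemma rodrigues_factorN1 n :
  rodrigues n = ('X - (-1)%:P) ^+ n * (((2 ^ n * n`!)%:R)^-1 *: ('X - 1) ^+ n).
Proof.
rewrite /rodrigues -scalerAr -exprMn; congr (_ *: _ ^+ _).
by rewrite polyCN polyC1; ring.
Qed.

Lemma derivn_rodrigues_1 n j : (j < n)%N -> ((rodrigues n)^`(j)).[1] = 0.
Proof. by rewrite rodrigues_factor1; apply: (derivn_XsubC_exp 1 n _).1. Qed.

Lemma derivn_rodrigues_N1 n j : (j < n)%N -> ((rodrigues n)^`(j)).[-1] = 0.
Proof. by rewrite rodrigues_factorN1; apply: (derivn_XsubC_exp (-1) n _).1. Qed.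

Lemma legendre_1 n : (legendre n).[1] = 1.
Proof.
rewrite /legendre rodrigues_factor1 (derivn_XsubC_exp 1 n _).2.
rewrite hornerZ horner_exp (_ : ('X + 1 : {poly R}).[1] = 2%:R); last by rewrite !hornerE.
by rewrite -natrX mulrCA -natrM mulnC mulVf// mulnC rodrigues_const_neq0.
Qed.

Lemma legendre_N1 n : (legendre n).[-1] = (-1) ^+ n.
Proof.
rewrite /legendre rodrigues_factorN1 (derivn_XsubC_exp (-1) n _).2.
rewrite hornerZ horner_exp (_ : ('X - 1 : {poly R}).[-1] = -1 * 2%:R); last first.
  by rewrite !hornerE; ring.
rewrite exprMn -natrX mulrCA (mulrCA n`!%:R) mulrCA -natrM [(n`! * _)%N]mulnC.
by rewrite mulVf ?mulr1.
Qed.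

Lemma legendre0 : legendre 0 = 1.
Proof. by rewrite /legendre derivn0 rodrigues0. Qed.

Lemma legendre1 : legendre 1 = 'X.
Proof. by rewrite /legendre derivn1 deriv_rodrigues rodrigues0 mulr1. Qed.

Lemma deriv_legendre n :
  (2 * n + 3)%:R *: legendre n.+1 = (legendre n.+2)^`() - (legendre n)^`().
Proof.
rewrite /legendre -!derivnS.
have -> : (rodrigues n.+2)^`(n.+3) = ((rodrigues n.+2)^`(2))^`(n.+1).
  by rewrite !derivSn.
by rewrite deriv2_rodrigues derivnD derivnZ addrK.
Qed.

(** Iterated integration from -1 undoes derivatives, because the derivatives of
    (X^2 - 1)^n of order < n vanish at -1. *)
Lemma iter_antideriv_legendre n j : (j <= n)%N ->
  iter j (antideriv (-1)) (legendre n) = (rodrigues n)^`(n - j).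
Proof.
elim: j => [|j IH] jn; first by rewrite subn0.
rewrite iterS (IH (ltnW jn)); apply: antideriv_unique; last first.
  by rewrite derivn_rodrigues_N1//; lia.
by rewrite (_ : n - j = (n - j.+1).+1)%N; [rewrite derivnS|lia].
Qed.

Lemma antideriv_legendre n :
  (2 * n + 3)%:R *: antideriv (-1) (legendre n.+1) = legendre n.+2 - legendre n.
Proof.
rewrite -linearZ; apply: antideriv_unique; first by rewrite derivB deriv_legendre.
by rewrite hornerD hornerN !legendre_N1 !exprS; ring.
Qed.

Lemma legendre_orthogonal n q : (size q <= n)%N -> polyint (-1) 1 (legendre n * q) = 0.
Proof.
have H j : forall q, (j <= n)%N -> (size q <= j)%N ->
    polyint (-1) 1 ((rodrigues n)^`(j) * q) = 0.
  elim: j => [|j IH] {}q jn.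
    by rewrite leqn0 size_poly_eq0 => /eqP->; rewrite mulr0 polyint0.
  move=> qj; rewrite derivnS polyint_by_parts derivn_rodrigues_1// derivn_rodrigues_N1//.
  rewrite !mul0r subrr sub0r IH ?oppr0//; first exact: ltnW.
  have [->|q0] := eqVneq q 0; first by rewrite deriv0 size_poly0.
  by rewrite -ltnS (leq_trans (lt_size_deriv q0)).
exact: H.
Qed.

Lemma size_rodrigues n : (size (rodrigues n) <= (n + n).+1)%N.
Proof.
rewrite /rodrigues (leq_trans (size_scale_leq _ _))// (leq_trans (size_poly_exp_leq _ _))//.
by rewrite size_XnsubC//= addnn mul2n.
Qed.

Lemma size_legendre n : (size (legendre n) <= n.+1)%N.
Proof.
apply/leq_sizeP => j nj; rewrite /legendre coef_derivn.
have sz : (size (rodrigues n) <= n + j)%N.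
  by rewrite (leq_trans (size_rodrigues n))// -addnS leq_add2l.
by rewrite (nth_default _ sz) mul0rn.
Qed.

(** By the derivative relation the norm reduces to the boundary values of
    L_(n+1) L_(n+2), all other terms being orthogonal for reasons of degree. *)
Lemma legendre_sqr n : (2 * n + 1)%:R * polyint (-1) 1 (legendre n * legendre n) = 2.
Proof.
case: n => [|n].
  rewrite legendre0 mulr1 muln0 mul1r.
  have -> : (1 : {poly R}) = ('X : {poly R})^`() by rewrite derivX.
  by rewrite polyint_deriv !hornerX; ring.
have -> : (2 * n.+1 + 1 = 2 * n + 3)%N by lia.
rewrite -polyintZ scalerAl deriv_legendre mulrBl polyintB.
have ds m : (size (legendre m)^`() <= m)%N.
  have [->|q0] := eqVneq (legendre m) 0; first by rewrite deriv0 size_poly0.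
  by rewrite -ltnS (leq_trans (lt_size_deriv q0))// size_legendre.
rewrite [X in _ - X](_ : _ = 0) ?subr0; last first.
  by rewrite mulrC legendre_orthogonal// (leq_trans (ds n)).
rewrite polyint_by_parts [X in _ - X](_ : _ = 0) ?subr0; last first.
  by rewrite legendre_orthogonal// (leq_trans (ds n.+1)).
rewrite !legendre_1 !legendre_N1 mulr1 -exprD.
rewrite (_ : n.+2 + n.+1 = (2 * n.+1).+1)%N; last by lia.
by rewrite exprS exprM sqrrN !expr1n; ring.
Qed.

Lemma coef_legendre_neq0 n : (legendre n)`_n != 0.
Proof.
rewrite /legendre coef_derivn /rodrigues coefZ.
have mon : ('X^2 - 1 : {poly R}) ^+ n \is monic by rewrite monic_exp// monicXnsubC.
have -> : (('X^2 - 1 : {poly R}) ^+ n)`_(n + n) = 1.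
  have /monicP := mon; rewrite /lead_coef.
  by rewrite size_exp size_XnsubC//= mul2n addnn.
rewrite mulr1 mulrn_eq0 negb_or invr_neq0 ?rodrigues_const_neq0//.
by rewrite -lt0n ffact_gt0 leq_addr.
Qed.

(** The Legendre polynomials with n < r span the polynomials of degree < r, so a
    linear form may be tested on them. *)
Lemma legendre_ind (r : nat) (Phi : {poly R} -> R) :
  (forall p q, Phi (p + q) = Phi p + Phi q) -> (forall c p, Phi (c *: p) = c * Phi p) ->
  (forall n, (n < r)%N -> Phi (legendre n) = 0) ->
  forall p, (size p <= r)%N -> Phi p = 0.
Proof.
move=> PhiD PhiZ; have Phi0 : Phi 0 = 0 by rewrite -(scale0r 0) PhiZ mul0r.
elim: r => [_ p|r IH PhiL p pr].
  by rewrite leqn0 size_poly_eq0 => /eqP->.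
pose c := p`_r / (legendre r)`_r.
rewrite -[p](subrK (c *: legendre r)) PhiD PhiZ PhiL// mulr0 addr0.
apply: IH => [n nr|]; first by apply: PhiL; rewrite ltnS ltnW.
apply/leq_sizeP => j; rewrite leq_eqVlt => /predU1P[<-|rj].
  by rewrite coefB coefZ /c divfK ?subrr// coef_legendre_neq0.
rewrite coefB coefZ (nth_default _ (leq_trans pr rj)).
by rewrite (nth_default _ (leq_trans (size_legendre r) rj)) mulr0 subrr.
Qed.

End Legendre.

(** * The representing splines and their squared norm *)

Section GreenPieces.
Context {R : realFieldType}.
Implicit Types (p q : {poly R}) (x : R).
Variables s k : nat.
Let r := (s + k).+1.

(** The Legendre polynomial integrated s times from -1. *)
Definition legendre_int n : {poly R} := iter s (antideriv (-1)) (legendre n).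

Lemma legendre_int_at n x :
  polyint (-1) x (legendre n * taylor_ker x s) = (antideriv (-1) (legendre_int n)).[x].
Proof. by rewrite (polyint_taylor_ker (-1) x s 0) addn0. Qed.

(** The squared norm of the truncated power (x - t)_+^s / s! on [-1, 1] minus that
    of its projection on the polynomials of degree < r, as a polynomial in x. *)
Definition extremal_value : {poly R} :=
  ((2 * s)`!%:R / (s`!%:R ^+ 2 * (2 * s).+1`!%:R)) *: ('X + 1) ^+ (2 * s).+1 -
  \sum_(n < r) ((2 * n + 1)%:R / 2) *: (antideriv (-1) (legendre_int n)) ^+ 2.

(** The orthogonal projection, on [-1, 1], of the truncated power
    (x - t)_+^s / s! on the polynomials of degree < r, expanded in Legendre
    polynomials: (2 n + 1) / 2 is the inverse of the squared norm of L_n. *)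
Definition taylor_proj x : {poly R} :=
  \sum_(n < r) ((2 * n + 1)%:R / 2 * (antideriv (-1) (legendre_int n)).[x]) *: legendre n.

Lemma size_taylor_proj x : (size (taylor_proj x) <= r)%N.
Proof.
apply: (leq_trans (size_sum _ _ _)); apply/bigmax_leqP => n _.
rewrite (leq_trans (size_scale_leq _ _))// (leq_trans (size_legendre n))//.
Qed.

Lemma taylor_projP x q : (size q <= r)%N ->
  polyint (-1) 1 (taylor_proj x * q) = polyint (-1) x (taylor_ker x s * q).
Proof.
move=> qr; apply/eqP; rewrite -subr_eq0; apply/eqP; move: q qr.
apply: legendre_ind => [p q|c p|n nr].
- by rewrite !mulrDr !polyintD; ring.
- by rewrite -!scalerAr !polyintZ; ring.
rewrite [taylor_ker x s * _]mulrC legendre_int_at /taylor_proj mulr_suml polyint_sum.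
rewrite (bigD1 (Ordinal nr))//= big1 ?addr0 => [|i ni]; last first.
  rewrite -scalerAl polyintZ.
  have [lin|lni] := leqP i n.
    rewrite [legendre i * _]mulrC legendre_orthogonal ?mulr0//.
    rewrite (leq_trans (size_legendre i))// ltn_neqAle lin andbT.
    by apply: contraNN ni => /eqP ni; apply/eqP/val_inj.
  by rewrite legendre_orthogonal ?mulr0// (leq_trans (size_legendre n)).
rewrite -scalerAl polyintZ mulrAC.
have /(congr1 (fun z => z / 2)) := @legendre_sqr R n.
rewrite divff ?pnatr_eq0// [X in X * _ - _]mulrAC => ->; rewrite mul1r subrr//.
Qed.

Lemma polyint_taylor_ker_sqr x : polyint (-1) x (taylor_ker x s * taylor_ker x s) =
  (2 * s)`!%:R / (s`!%:R ^+ 2 * (2 * s).+1`!%:R) * (x + 1) ^+ (2 * s).+1.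
Proof.
have -> : taylor_ker x s * taylor_ker x s =
    (- ((2 * s)`!%:R / s`!%:R ^+ 2)) *: (taylor_ker x (2 * s).+1)^`().
  rewrite deriv_taylor_ker scalerN scaleNr opprK /taylor_ker -scalerAl -scalerAr !scalerA -exprD.
  rewrite addnn -mul2n; congr (_ *: _).
  have f0 n : n`!%:R != 0 :> R by rewrite pnatr_eq0 -lt0n fact_gt0.
  move: (f0 s) (f0 (2 * s)%N); move: (s`!%:R) ((2 * s)`!%:R) => u v u0 v0.
  by field; rewrite ?u0 ?v0.
rewrite polyintZ polyint_deriv taylor_ker_at sub0r mulrNN /taylor_ker hornerZ
  horner_exp !(hornerD, hornerN, hornerC, hornerX) opprK.
have f0 n : n`!%:R != 0 :> R by rewrite pnatr_eq0 -lt0n fact_gt0.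
move: (f0 s) (f0 (2 * s).+1); move: (s`!%:R) ((2 * s).+1`!%:R) => u v u0 v0.
by field; rewrite ?u0 ?v0.
Qed.

(** The pieces on [-1, x] and [x, 1] of the function of the space whose derivative
    of order r represents f |-> f^(k)(x).  That derivative is the truncated power
    minus its projection; P is its iterated integral from -1.  Orthogonality to
    the polynomials of degree < r is what makes the derivatives of order < r
    vanish at 1 as well. *)
Lemma green_pieces x : exists P Q : {poly R},
  [/\ (forall j, (j < r)%N -> (P^`(j)).[-1] = 0),
      (forall j, (j < r)%N -> (Q^`(j)).[1] = 0),
      P - Q = (-1) ^+ r *: taylor_ker x (s + r),
      (size (P^`(r)) <= r)%N /\ (size (Q^`(r)) <= r)%N
    & (P^`(k)).[x] = extremal_value.[x]].
Proof.
pose p1 := taylor_ker x s - taylor_proj x.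
pose P := iter r (antideriv (-1)) p1.
pose Q := P - iter r (antideriv x) (taylor_ker x s).
have PE j i : r = (j + i)%N -> P^`(j) = iter i (antideriv (-1)) p1.
  by move=> rji; rewrite /P rji derivn_iter_antideriv.
have QE j i : r = (j + i)%N -> Q^`(j) = iter i (antideriv (-1)) p1 -
    iter i (antideriv x) (taylor_ker x s).
  by move=> rji; rewrite /Q derivnB (PE _ _ rji) rji derivn_iter_antideriv.
have sz : (size p1 <= r)%N.
  rewrite (leq_trans (size_polyD _ _))// geq_max size_polyN size_taylor_proj andbT.
  by rewrite (leq_trans (size_taylor_ker _ _))// ltnS leq_addr.
exists P, Q; split.
- move=> j jr; rewrite (PE _ (r - j.+1).+1) ?iterS ?antideriv_at//; lia.
- move=> j jr; rewrite (QE _ (r - j.+1).+1); last by lia.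
  set i := (r - j.+1)%N.
  have sK : (size (taylor_ker (1 : R) i) <= r)%N.
    by rewrite (leq_trans (size_taylor_ker _ _))//; rewrite /i; lia.
  have C a p : (iter i.+1 (antideriv a) p).[1] = polyint a 1 (p * taylor_ker 1 i).
    by rewrite (polyint_taylor_ker a 1 i 0) addn0.
  rewrite hornerD hornerN !C.
  rewrite /p1 mulrBl polyintB taylor_projP// -(polyint_chasles (-1) x 1); ring.
- by rewrite /Q opprB addrC subrK iter_antideriv_taylor_ker.
- rewrite (PE _ 0%N) ?addn0// (QE _ 0%N) ?addn0//=; split => //.
  by rewrite /p1 addrAC subrr sub0r size_polyN size_taylor_proj.
- rewrite (PE _ s.+1); last by rewrite /r addnC addnS.
  have -> : (iter s.+1 (antideriv (-1)) p1).[x] = polyint (-1) x (p1 * taylor_ker x s).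
    by rewrite (polyint_taylor_ker (-1) x s 0) addn0.
  rewrite /p1 mulrBl polyintB polyint_taylor_ker_sqr.
  rewrite /extremal_value hornerD hornerN hornerZ horner_exp !hornerE horner_sum.
  congr (_ - _); rewrite /taylor_proj mulr_suml polyint_sum; apply: eq_bigr => n _.
  by rewrite -scalerAl polyintZ legendre_int_at hornerZ horner_exp; ring.
Qed.

(** Each term is a difference of consecutive products, because integrating L_(i+1)
    gives L_(i+2) - L_i up to the factor 2 i + 3; only the ends of the telescope
    remain. *)
Lemma sum_legendre_int n :
  \sum_(i < n.+1) (2 * i + 1)%:R *: (antideriv (-1) (legendre_int i) * legendre_int i) =
  legendre_int 0 ^+ 2 + legendre_int n.+1 * legendre_int n.
Proof.
have A0 : antideriv (-1) (legendre_int 0) = legendre_int 1 + legendre_int 0.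
  rewrite /legendre_int -iterS iterSr -iter_antiderivD; congr (iter _ _ _).
  apply: antideriv_unique.
    by rewrite legendre1 legendre0 derivD derivX -polyC1 derivC addr0.
  by rewrite hornerD !legendre_N1 expr0 expr1 addNr.
have AS i : (2 * i + 3)%:R *: antideriv (-1) (legendre_int i.+1) =
    legendre_int i.+2 - legendre_int i.
  by rewrite /legendre_int -iterS iterSr -iter_antiderivZ antideriv_legendre iter_antiderivB.
elim: n => [|n IH].
  by rewrite big_ord_recl big_ord0 addr0 muln0 scale1r A0; ring.
rewrite big_ord_recr IH /= scalerAl (_ : 2 * n.+1 + 1 = 2 * n + 3)%N; last by lia.
by rewrite AS; ring.
Qed.

(** The square of [legendre_int 0] in the telescoped sum is the derivative of the
    squared norm of the truncated power, and cancels it. *)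
Lemma deriv_extremal_value : extremal_value^`() =
  - ((rodrigues r)^`(k.+1) * (rodrigues (s + k))^`(k)).
Proof.
have y0 : legendre_int 0 ^+ 2 = (s`!%:R ^- 2) *: ('X + 1) ^+ (2 * s).
  have -> : legendre_int 0 = s`!%:R^-1 *: ('X + 1) ^+ s.
    rewrite /legendre_int legendre0; elim: (s) => [|i IH].
      by rewrite fact0 invr1 scale1r expr0.
    rewrite iterS IH; apply: antideriv_unique.
      rewrite derivZ deriv_exp derivD derivX -polyC1 derivC addr0 mul1r /=.
      by rewrite -scaler_nat scalerA factS natrM invfM mulrAC mulVf ?mul1r.
    by rewrite hornerZ horner_exp !hornerE addNr expr0n mulr0.
  by rewrite exprZn -exprM mulnC exprVn.
have yr : legendre_int r = (rodrigues r)^`(k.+1).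
  rewrite /legendre_int iter_antideriv_legendre; last by rewrite /r; lia.
  by congr derivn; rewrite /r; lia.
have yr1 : legendre_int (s + k) = (rodrigues (s + k))^`(k).
  rewrite /legendre_int iter_antideriv_legendre; last by lia.
  by congr derivn; lia.
rewrite -yr -yr1 /extremal_value derivB derivZ deriv_exp derivD derivX -polyC1 derivC addr0 mul1r /=.
have -> : (\sum_(n < r) ((2 * n + 1)%:R / 2) *: (antideriv (-1) (legendre_int n)) ^+ 2)^`()
    = legendre_int 0 ^+ 2 + legendre_int r * legendre_int (s + k).
  rewrite -sum_legendre_int (raddf_sum (@deriv R)); apply: eq_bigr => n _.
  rewrite /= derivZ deriv_exp antiderivK expr1 -scaler_nat scalerA divfK ?pnatr_eq0//.
  by rewrite [X in _ *: X]mulrC.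
rewrite y0 polyC1 -scaler_nat scalerA opprD addrA [X in X + _](_ : _ = 0) ?add0r//.
apply/eqP; rewrite subr_eq0; apply/eqP; congr (_ *: _).
have f0 n : n`!%:R != 0 :> R by rewrite pnatr_eq0 -lt0n fact_gt0.
have n0 : (2 * s).+1%:R != 0 :> R by rewrite pnatr_eq0.
rewrite factS natrM; move: n0 (f0 s) (f0 (2 * s)%N).
move: ((2 * s).+1%:R) (s`!%:R) ((2 * s)`!%:R) => z u v z0 u0 v0.
by field; rewrite ?u0 ?v0 ?z0.
Qed.

End GreenPieces.

Import numFieldNormedType.Exports.

(** * The squared norm near the midpoint *)

Section ExtremalValueAtZero.
Local Open Scope classical_set_scope.
Local Open Scope ring_scope.
Context {R : realType}.
Implicit Types (p q : {poly R}) (x : R).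

Lemma poly_MVT p (a b : R) : a < b ->
  exists2 c, a < c < b & p.[b] - p.[a] = p^`().[c] * (b - a).
Proof.
move=> ab.
have dp (x : R) : x \in `]a, b[%R -> is_derive x 1 (horner p) p^`().[x].
  by move=> _; exact: is_derive_poly.
have cp : {within `[a, b]%classic, continuous (horner p)}.
  by apply: continuous_subspaceT; exact: continuous_horner.
have [c cab E] := MVT ab dp cp.
by exists c => //; move: cab; rewrite in_itv.
Qed.

Lemma derivn_mulX n p : ('X * p)^`(n) = 'X * p^`(n) + n%:R *: p^`(n.-1).
Proof.
elim: n p => [|n IH] p; first by rewrite !derivn0 scale0r addr0.
rewrite derivSn derivM derivX mul1r derivnD IH -derivSn /=.
rewrite -natr1 scalerDl scale1r; case: n {IH} => [|n]; last by rewrite -derivSn /=; ring.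
by rewrite !scale0r !derivn0 ; ring.
Qed.

(** V_(n+1)' = X V_n: at 0 only the derivative of X contributes, which relates
    the values for n + 1 and n and determines all of them. *)
Lemma derivn_rodrigues_0S n j :
  ((rodrigues n.+1)^`(j.+2)).[0] = j.+1%:R * ((rodrigues n)^`(j)).[0] :> R.
Proof.
by rewrite derivSn deriv_rodrigues derivn_mulX hornerD hornerM hornerX mul0r add0r hornerZ.
Qed.

Lemma derivn_rodrigues_0_odd n j : odd j -> ((rodrigues n)^`(j)).[0] = 0 :> R.
Proof.
elim/ltn_ind: j n => -[|[|j]] IH [|n] // oj.
- by rewrite rodrigues0 derivn1 -polyC1 derivC horner0.
- by rewrite derivn1 deriv_rodrigues hornerM hornerX mul0r.
- by rewrite rodrigues0 derivSn -polyC1 derivC derivnC horner0.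
- by rewrite derivn_rodrigues_0S IH ?mulr0//; move: oj; rewrite /= negbK.
Qed.

Lemma derivn_rodrigues_0_even n i : (i <= n)%N ->
  0 < (-1) ^+ (n - i) * ((rodrigues n)^`(2 * i)).[0] :> R.
Proof.
elim: i n => [|i IH] [|n] //.
- by rewrite muln0 derivn0 rodrigues0 hornerC expr0 mulr1.
- move=> _; rewrite muln0 derivn0 subn0 /rodrigues hornerZ horner_exp.
  have -> : ('X^2 - 1 : {poly R}).[0] = -1 by rewrite !hornerE expr0n sub0r.
  rewrite mulrCA -exprMn mulrNN mulr1 expr1n mulr1.
  by rewrite invr_gt0 ltr0n muln_gt0 expn_gt0 fact_gt0.
- move=> i_n; rewrite subSS mulnS /= derivn_rodrigues_0S mulrCA mulr_gt0 ?ltr0n//.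
  exact: IH.
Qed.

Variables s k : nat.
Let N : {poly R} := extremal_value s k.

(** Adding (k / 2) w^2 >= 0, where w is a derivative of odd order k - 1 of an even
    polynomial and so vanishes at 0, completes the derivative of [N] to
    - X u^2. *)
Lemma extremal_value_le_at0 x : ~~ odd k -> N.[x] <= N.[0].
Proof.
move=> ek; pose V : {poly R} := rodrigues (s + k).
pose w := V^`(k.-1); pose M := N + (k%:R / 2) *: w ^+ 2.
have M' : M^`() = - ('X * V^`(k) ^+ 2).
  rewrite derivD deriv_extremal_value derivSn deriv_rodrigues derivn_mulX -/V derivZ.
  have -> : (w ^+ 2)^`() = 2%:R *: (w^`() * w) by rewrite scaler_nat deriv_exp expr1.
  rewrite scalerA divfK ?pnatr_eq0// /w.
  case: (k) => [|k']; first by rewrite !scale0r; ring.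
  by rewrite -derivnS /= -!mul_polyC; ring.
have w0 : k%:R * w.[0] = 0.
  rewrite /w /V; move: (s + k)%N => n; case: (k) ek => [|k'] /= ek; first by rewrite mul0r.
  by rewrite derivn_rodrigues_0_odd ?mulr0//; move: ek; rewrite negbK.
have M0 : M.[0] = N.[0].
  by rewrite [M.[0]]hornerD hornerZ horner_exp expr2 mulrA (mulrAC k%:R) w0 !mul0r addr0.
have NM : N.[x] <= M.[x].
  by rewrite [M.[x]]hornerD lerDl hornerZ horner_exp mulr_ge0 ?sqr_ge0 ?divr_ge0 ?ler0n.
apply: le_trans NM _; rewrite -M0.
have [x0|x0|->//] := ltgtP x 0.
- have [c /andP[_ c0] E] := poly_MVT M x0.
  rewrite -subr_ge0 E sub0r M' hornerN hornerM hornerX horner_exp mulr_ge0//; last first.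
    by rewrite oppr_ge0 ltW.
  by rewrite -mulNr mulr_ge0 ?sqr_ge0// oppr_ge0 ltW.
- have [c /andP[c0 _] E] := poly_MVT M x0.
  rewrite -subr_le0 E subr0 M' hornerN hornerM hornerX horner_exp mulNr oppr_le0.
  by apply: mulr_ge0 (ltW x0); apply: mulr_ge0 (ltW c0) (sqr_ge0 _).
Qed.

(** At 0 the first derivative of [N] vanishes by parity, and the second one is minus
    the product of two derivatives of even order whose signs are opposite. *)
Lemma extremal_value_gt_at0 : odd k -> exists2 x, 0 < x < 1 & N.[0] < N.[x].
Proof.
move=> ok; pose N1 := N^`(); pose N2 := N1^`().
have k0 : (0 < k)%N by case: (k) ok.
pose i := (k.+1)./2.
have ki : (k.+1 = 2 * i)%N by rewrite /i; lia.
have N10 : N1.[0] = 0.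
  by rewrite /N1 deriv_extremal_value hornerN hornerM (derivn_rodrigues_0_odd (s + k) ok) mulr0 oppr0.
have N20 : 0 < N2.[0].
  rewrite /N2 /N1 deriv_extremal_value derivN derivM hornerN hornerD !hornerM.
  rewrite (derivn_rodrigues_0_odd (s + k) ok) mulr0 add0r -derivnS ki.
  have i1 : (i <= s + k)%N by lia.
  have := mulr_gt0 (derivn_rodrigues_0_even i1) (derivn_rodrigues_0_even (leqW i1)).
  rewrite subSn// exprS; set e := (-1) ^+ _; set A := _.[0]; set B := _.[0].
  have -> : e * A * (-1 * e * B) = e ^+ 2 * (- (B * A)) by ring.
  by rewrite /e sqrr_sign mul1r.
have /nbhs_ballP[d /= d0 Hd] : \forall y \near (0 : R), 0 < N2.[y].
  by apply: (cvgr_gt _ (@continuous_horner R N2 0)).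
(* Any point of ]0, d[ that is below 1 will do. *)
pose x := Num.min (d / 2) (1 / 2).
have x0 : 0 < x by rewrite lt_min !divr_gt0.
have xd : x < d by rewrite gt_min; apply/orP; left; lra.
have x1 : x < 1 by rewrite gt_min; apply/orP; right; lra.
exists x; first by rewrite x0.
(* Two applications of the mean value theorem: N'(0) = 0 and N'' > 0 on ]0, d[. *)
have [c /andP[c0 cx] E] := poly_MVT N x0.
have [c' /andP[c'0 c'c] E'] := poly_MVT N1 c0.
rewrite -subr_gt0 E subr0 mulr_gt0//.
move: E'; rewrite N10 !subr0 => ->; rewrite mulr_gt0//.
apply: Hd; rewrite /ball /= sub0r normrN gtr0_norm//.
exact: lt_trans (lt_trans c'c cx) xd.
Qed.
End ExtremalValueAtZero.

Local Open Scope classical_set_scope.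

(** * Total variation of absolutely continuous functions *)

Section AbsolutelyContinuous.
Context {R : realType}.
Implicit Types (a b : R) (F : R -> R).

Lemma ac_fintype a b F (e : R) : absolutely_continuous a b F -> 0 < e ->
  exists2 d : R, 0 < d & forall (T : finType) (u v : T -> R),
    (forall i, a <= u i /\ u i <= v i /\ v i <= b) ->
    trivIset [set: T] (fun i => `]u i, v i[) ->
    \sum_i (v i - u i) < d -> \sum_i `|F (v i) - F (u i)| < e.
Proof.
move=> acF e0; have [d d0 Hd] := acF e e0.
exists d => // T u v uv tI.
rewrite (reindex (@enum_val T T)) /=; last first.
  by exists enum_rank => x _; [exact: enum_valK|exact: enum_rankK].
rewrite [X in _ -> X < _](reindex (@enum_val T T)) /=; last first.
  by exists enum_rank => x _; [exact: enum_valK|exact: enum_rankK].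
apply: Hd => [i|]; first exact: uv.
move=> i j _ _ ij; apply: enum_val_inj; exact: tI.
Qed.

Lemma ac_uniform a b F (e : R) : absolutely_continuous a b F -> 0 < e ->
  exists2 d : R, 0 < d & forall x y, a <= x -> x <= y -> y <= b -> y - x < d ->
    `|F y - F x| < e.
Proof.
move=> acF e0; have [d d0 Hd] := acF e e0.
exists d => // x y ax xy yb xyd.
have := Hd 1%N (fun=> x) (fun=> y); rewrite !big_ord1; apply => //.
by move=> i j _ _ _; rewrite (ord1 i) (ord1 j).
Qed.

(** The pieces of finitely many partitions of disjoint intervals are again
    disjoint, so total variations over short families are small. *)
Lemma ac_sum_variation a b F (e : R) : absolutely_continuous a b F -> 0 < e ->
  exists2 d : R, 0 < d & forall (n : nat) (u v : 'I_n -> R) (s : 'I_n -> seq R),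
    (forall i, a <= u i /\ u i <= v i /\ v i <= b) ->
    trivIset [set: 'I_n] (fun i => `]u i, v i[) ->
    (forall i, itv_partition (u i) (v i) (s i)) ->
    \sum_(i < n) (v i - u i) < d ->
    \sum_(i < n) variation (u i) (v i) F (s i) < e.
Proof.
move=> acF e0; have [d d0 Hd] := ac_fintype acF e0.
exists d => // n u v s uv tI ps sd.
pose p i := nth (v i) (u i :: s i).
have p_lt i j k : (j < k)%N -> (k < (size (s i)).+1)%N -> p i j < p i k.
  move=> jk ks; have [sp _] := ps i.
  rewrite /p; apply: (@sorted_ltn_nth _ <%O lt_trans (v i) (u i :: s i)) => //;
    by rewrite inE //= (ltn_trans jk).
have p_le i j k : (j <= k)%N -> (k < (size (s i)).+1)%N -> p i j <= p i k.
  by rewrite leq_eqVlt => /predU1P[->//|jk ks]; exact/ltW/p_lt.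
have p0 i : p i 0%N = u i by [].
have pl i : p i (size (s i)) = v i.
  by have [_ /eqP] := ps i; rewrite /p -[X in nth _ _ X]/((size (u i :: s i)).-1) nth_last.
pose T := {i : 'I_n & 'I_(size (s i))}.
pose U (t : T) := p (tag t) (tagged t).
pose W (t : T) := p (tag t) (tagged t).+1.
have -> : \sum_(i < n) variation (u i) (v i) F (s i) =
          \sum_(t : T) `|F (W t) - F (U t)|.
  pose G (i : 'I_n) (j : 'I_(size (s i))) := `|F (p i j.+1) - F (p i j)|.
  under eq_bigr do rewrite /variation big_mkord.
  by rewrite (sig_big_dep _ (fun=> xpredT) G).
have sumE : \sum_(t : T) (W t - U t) = \sum_(i < n) (v i - u i).
  pose G (i : 'I_n) (j : 'I_(size (s i))) := p i j.+1 - p i j.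
  transitivity (\sum_(i < n) \sum_(j < size (s i)) G i j).
    by rewrite (sig_big_dep _ (fun=> xpredT) G).
  apply: eq_bigr => i _.
  rewrite -(big_mkord xpredT (fun j => p i j.+1 - p i j)) telescope_sumr//.
  by rewrite pl p0.
apply: Hd; last by rewrite sumE.
- case=> i j; rewrite /U /W /=; have [au [uvi vb]] := uv i.
  have js := ltn_ord j.
  have := p_le i 0%N j isT (leqW js); have := p_le i j j.+1 (leqnSn j) js.
  have := p_le i j.+1 (size (s i)) js (ltnSn _); rewrite p0 pl => h1 h2 h3.
  by split; [exact: le_trans h3|split => //; exact: le_trans vb].
- case=> i j; case=> i' j' _ _ [x [/=]]; rewrite /U /W /= !in_itv/=.
  move=> /andP[x1 x2] /andP[x3 x4].
  have inside l (k : 'I_(size (s l))) : p l k < x -> x < p l k.+1 -> u l < x < v l.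
    move=> y1 y2; rewrite -p0 -pl (le_lt_trans _ y1)/= ?(lt_le_trans y2)//.
      by rewrite p_le.
    by rewrite p_le// leqW.
  have ii' : i = i'.
    by apply: tI => //; exists x; split => /=; rewrite in_itv/=; apply: inside; eassumption.
  move: j' x3 x4; case: _ / ii' => j' x3 x4; congr existT; apply/val_inj/eqP.
  rewrite eqn_leq; apply/andP; split; rewrite leqNgt; apply/negP => jj.
  + by have := lt_trans x1 x4; rewrite ltNge p_le// leqW.
  + by have := lt_trans x3 x2; rewrite ltNge p_le// leqW.
Qed.

(** On intervals shorter than the d that belongs to e = 1 the variation is at most
    1, and boundedly many of them cover [a, b]. *)
Lemma ac_bounded_variation a b F : a <= b -> absolutely_continuous a b F ->
  bounded_variation a b F.
Proof.
move=> ab acF; have [d d0 Hd] := ac_sum_variation acF ltr01.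
have short x y : a <= x -> x <= y -> y <= b -> y - x < d ->
    total_variation x y F \is a fin_num.
  move=> ax xy yb xyd; apply/bounded_variationP => //.
  exists 1 => _ [s ps <-]; apply: ltW.
  have := Hd 1%N (fun=> x) (fun=> y) (fun=> s); rewrite !big_ord1; apply => //.
  by move=> i j _ _ _; rewrite (ord1 i) (ord1 j).
have h0 : 0 < d / 2 by rewrite divr_gt0.
have step n : forall y, a <= y -> y <= b -> y - a < n%:R * (d / 2) ->
    total_variation a y F \is a fin_num.
  elim: n => [y ay yb|n IH y ay yb]; first by rewrite mul0r subr_lt0 ltNge ay.
  rewrite -natr1 mulrDl mul1r => yn.
  have [ya|ya] := leP (y - d / 2) a.
    apply: short => //; lra.
  have az : a <= y - d / 2 by exact: ltW.
  have zy : y - d / 2 <= y by lra.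
  rewrite (total_variationD F az zy) fin_numD IH ?short //; lra.
apply/bounded_variationP => //.
pose m := Num.trunc ((b - a) / (d / 2)).
apply: (step m.+1) => //.
by rewrite -ltr_pdivrMr// truncnS_gt.
Qed.

Definition variation_from a F x : R := fine (total_variation a x F).

Lemma ac_tv_fin a b F x y : absolutely_continuous a b F ->
  a <= x -> x <= y -> y <= b -> total_variation x y F \is a fin_num.
Proof.
move=> acF ax xy yb; apply/bounded_variationP => //.
have ab : a <= b by rewrite (le_trans ax)// (le_trans xy).
have : bounded_variation a b F by exact: ac_bounded_variation.
move=> /(bounded_variationl (le_trans ax xy) yb).
exact: bounded_variationr.
Qed.

Lemma variation_fromB a b F x y : absolutely_continuous a b F ->
  a <= x -> x <= y -> y <= b ->
  variation_from a F y - variation_from a F x = fine (total_variation x y F).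
Proof.
move=> acF ax xy yb; rewrite /variation_from (total_variationD F ax xy).
have f1 := ac_tv_fin acF (lexx a) ax (le_trans xy yb).
have f2 := ac_tv_fin acF ax xy yb.
by rewrite fineD// addrAC subrr add0r.
Qed.

(** Each total variation is approximated by the variation over a partition; the
    n errors add up to less than e / 2. *)
Lemma ac_variation_from a b F : absolutely_continuous a b F ->
  absolutely_continuous a b (variation_from a F).
Proof.
move=> acF e e0; have e2 : 0 < e / 2 by rewrite divr_gt0.
have [d d0 Hd] := ac_sum_variation acF e2.
exists d => // n u v uv tI sd.
have tvf i : total_variation (u i) (v i) F \is a fin_num.
  by have [au [uvi vb]] := uv i; exact: (ac_tv_fin acF).
have VE i : `|variation_from a F (v i) - variation_from a F (u i)| =
    fine (total_variation (u i) (v i) F).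
  have [au [uvi vb]] := uv i.
  by rewrite (variation_fromB acF)// ger0_norm// fine_ge0// total_variation_ge0.
have ex i : exists s, itv_partition (u i) (v i) s /\
    fine (total_variation (u i) (v i) F) <=
      variation (u i) (v i) F s + e / 2 / n.+1%:R.
  have [au [uvi vb]] := uv i.
  have en0 : 0 < e / 2 / n.+1%:R by rewrite divr_gt0.
  have : (total_variation (u i) (v i) F - (e / 2 / n.+1%:R)%:E
     < total_variation (u i) (v i) F)%E.
    by rewrite lteBlDr// lteDl.
  move=> /ereal_sup_gt[_ /= [_ [s ps <-] <-]] lts.
  exists s; split => //; move: lts.
  by rewrite -(fineK (tvf i)) -EFinD lte_fin ltrBlDr => /ltW.
pose s i := sval (cid (ex i)).
have [ps lts] : (forall i, itv_partition (u i) (v i) (s i)) /\ (forall i,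
    fine (total_variation (u i) (v i) F) <=
      variation (u i) (v i) F (s i) + e / 2 / n.+1%:R).
  by split=> i; rewrite /s; case: cid => x [].
have := Hd n u v s uv tI ps sd.
under [X in _ -> X < _]eq_bigr do rewrite VE.
move=> sv; apply: le_lt_trans (ler_sum _ (fun i _ => lts i)) _.
rewrite big_split/= sumr_const card_ord -[_ *+ n]mulr_natr.
have : e / 2 / n.+1%:R * n%:R <= e / 2.
  rewrite -mulrA ler_piMr ?(ltW e2)// mulrC ler_pdivrMr// mul1r ler_nat //.
by move=> le2; rewrite [ltRHS]splitr ltr_leD.
Qed.

Lemma ac_sub a b F G : absolutely_continuous a b F ->
  absolutely_continuous a b G -> absolutely_continuous a b (F \- G).
Proof.
move=> acF acG e e0; have e2 : 0 < e / 2 by rewrite divr_gt0.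
have [d1 d10 H1] := acF _ e2; have [d2 d20 H2] := acG _ e2.
exists (Num.min d1 d2); first by rewrite lt_min d10.
move=> n u v uv tI; rewrite lt_min => /andP[s1 s2].
have := H1 n u v uv tI s1; have := H2 n u v uv tI s2.
have : \sum_(i < n) `|(F \- G) (v i) - (F \- G) (u i)| <=
  \sum_(i < n) `|F (v i) - F (u i)| + \sum_(i < n) `|G (v i) - G (u i)|.
  rewrite -big_split/=; apply: ler_sum => i _.
  apply: le_trans (ler_normB _ _).
  by rewrite le_eqVlt; apply/orP; left; apply/eqP; congr `|_|; ring.
lra.
Qed.

End AbsolutelyContinuous.

(** * Densities of Lebesgue-Stieltjes measures *)

Section MonotoneDensity.
Context {R : realType}.
Implicit Types (a b : R) (F G : R -> R).
Notation lambda := (@lebesgue_measure R).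

(** Components of an open set of finite measure are bounded intervals; the empty
    set, which occurs in the enumeration of the components, is ]0, 0[. *)
Lemma open_interval_finite_measure (X : set R) : open X -> is_interval X ->
  (lambda X < +oo)%E -> exists u v : R, [/\ u <= v, X = `]u, v[ & lambda X = (v - u)%:E].
Proof.
move=> oX iX; have := iX => /is_intervalP XE.
have [X0|/eqP/set0P[x0 Xx0]] := pselect (X = set0); first rewrite X0.
  by move=> _; exists 0, 0; rewrite set_itvoo0 measure0 subrr.
have [lb|nlb] := pselect (has_lbound X); last first.
  rewrite {1}XE lebesgue_measure_itv /Rhull asboolF//=.
  by case: asbool; rewrite /= ?ltNyr ?ltNyy /= ?ltxx.
have [ub|nub] := pselect (has_ubound X); last first.
  rewrite {1}XE lebesgue_measure_itv /Rhull asboolT// (asboolF nub)/=.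
  by rewrite ltry.
move=> _; exists (inf X), (sup X).
have XE' : X = `]inf X, sup X[.
  by have := interval_bounded_interior iX lb ub; rewrite (interior_id X).1.
have lt_inf : inf X < sup X.
  by move: Xx0; rewrite {1}XE' /= in_itv/= => /andP[]; exact: lt_trans.
split; [exact: ltW|exact: XE'|].
by rewrite {1}XE' lebesgue_measure_itv /= lte_fin lt_inf EFinB.
Qed.

Section cumulative_ac.
Variable G : cumulative R R.
Hypothesis acG : forall e : R, 0 < e -> exists2 d : R, 0 < d &
    forall (n : nat) (u v : 'I_n -> R), (forall i, u i <= v i) ->
      trivIset [set: 'I_n] (fun i => `]u i, v i[) ->
      \sum_(i < n) (v i - u i) < d -> \sum_(i < n) (G (v i) - G (u i)) < e.

Let nu := lebesgue_stieltjes_measure G.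

Lemma stieltjes_itvoc (u v : R) : u <= v -> nu `]u, v] = (G v - G u)%:E.
Proof.
move=> uv; rewrite /nu /lebesgue_stieltjes_measure.
rewrite /measure_extension measurable_mu_extE/=; last exact: is_ocitv.
by rewrite wlength_itv_bnd.
Qed.

(** A null set lies in an open set of small Lebesgue measure, that is, in
    disjoint open intervals of small total length. *)
Lemma stieltjes_dominates : nu `<< lambda.
Proof.
apply/null_content_dominatesP => A mA A0.
apply/eqP; rewrite eq_le measure_ge0 andbT.
apply/lee_addgt0Pr => e e0; rewrite add0e.
have [d d0 Hd] := acG e0.
have [|U [oU AU Ud]] := lebesgue_regularity_outer mA _ d0; first by rewrite A0.
have mU : measurable U := open_measurable oU.
have {}Ud : (lambda U < d%:E)%E.
  apply: le_lt_trans Ud; rewrite -[leRHS]adde0 -A0.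
  rewrite -{1}(setDUK AU) setUC; apply: measureU2 => //; exact: measurableD.
pose I := open_disjoint_itv oU.
have oI i : open (I i) by exact: open_disjoint_itv_open.
have mI i : measurable (I i) by exact: open_measurable.
have UE : U = \bigcup_q I q by exact: open_disjoint_itv_bigcup.
have tI : trivIset setT I by exact: open_disjoint_itv_trivIset.
have sumU : (\sum_(0 <= i <oo) lambda (I i) = lambda U)%E.
  by rewrite UE measure_semi_bigcup// -UE.
have ub i : exists u v : R, [/\ u <= v, I i = `]u, v[ & lambda (I i) = (v - u)%:E].
  apply: open_interval_finite_measure => //.
    exact: open_disjoint_itv_is_interval.
  apply: le_lt_trans (lt_le_trans Ud (leey _)).
  apply: le_measure; rewrite ?inE; [exact: mI|exact: mU|].
  by move=> x Ix; rewrite UE; exists i.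
have {ub}[u [v uv]] : exists u v : nat -> R, forall i,
    [/\ u i <= v i, I i = `]u i, v i[ & lambda (I i) = (v i - u i)%:E].
  exists (fun i => sval (cid (ub i))), (fun i => sval (cid (svalP (cid (ub i))))).
  by move=> i; case: cid => ? ?/=; case: cid.
apply: le_trans (_ : nu U <= _)%E; first by apply: le_measure; rewrite ?inE.
have mbU : measurable (\bigcup_q I q) by rewrite -UE.
have -> : nu U = (\sum_(0 <= i <oo) nu (I i))%E.
  rewrite [in LHS]UE; exact: (measure_semi_bigcup (lebesgue_stieltjes_measure G)).
apply: lime_le; first by apply: is_cvg_nneseries => *; exact: measure_ge0.
near=> n; rewrite big_mkord.
apply: (@le_trans _ _ (\sum_(i < n) (G (v i) - G (u i))%:E)%E).
  apply: lee_sum => i _; have [uvi IE _] := uv i.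
  rewrite -stieltjes_itvoc// IE; apply: le_measure; rewrite ?inE.
  - exact: measurable_itv.
  - exact: measurable_itv.
  - exact: subset_itv_oo_oc.
rewrite sumEFin lee_fin; apply: ltW; apply: Hd => [i||].
- by have [] := uv i.
- move=> i j _ _ ij; apply: val_inj; apply: (tI i j) => //.
  by have [_ -> _] := uv i; have [_ -> _] := uv j.
- rewrite -lte_fin; apply: le_lt_trans Ud; rewrite -sumU -sumEFin.
  under eq_bigr => i _ do (have [_ _ <-] := uv i).
  by rewrite -(big_mkord xpredT (fun i => lambda (I i))); apply: nneseries_lim_ge.
Unshelve. all: by end_near. Qed.

(** Since G is constant outside [c, d], the measure is finite, and the
    Radon-Nikodym theorem applies. *)
Lemma stieltjes_density (c d : R) : (forall x, x <= c -> G x = G c) ->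
  (forall x, d <= x -> G x = G d) ->
  exists2 h : R -> R, lambda.-integrable setT (EFin \o h) &
    forall x y, x <= y -> G y - G x = \int[lambda]_(t in `]x, y]) h t.
Proof.
move=> Gc Gd.
have nuT : (nu setT < +oo)%E.
  rewrite -(bigcup_itvT false false).
  pose I n : set R := `]- (n%:R), n%:R]%classic.
  have mI n : measurable (I n) by exact: measurable_itv.
  have : (nu \o I) n @[n --> \oo] --> nu (\bigcup_n I n).
    apply: nondecreasing_cvg_mu; rewrite /I//; first exact: bigcup_measurable.
    by move=> p q pq; apply/subsetPset/subset_itv; rewrite leBSide/= ?lerN2 ler_nat.
  move=> /cvg_lim <-//; apply: le_lt_trans (ltry (G d - G c)).
  have GcG x : G c <= G x.
    have [/Gc->//|/ltW] := leP x c; exact: cumulative_is_nondecreasing.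
  have GdG x : G x <= G d.
    have [/Gd->//|/ltW] := leP d x; exact: cumulative_is_nondecreasing.
  apply: lime_le.
    apply: ereal_nondecreasing_is_cvgn => m n mn; rewrite /=.
    apply: le_measure; rewrite ?inE; [exact: mI|exact: mI|].
    by rewrite /I; apply: subset_itv; rewrite leBSide/= ?lerN2 ler_nat.
  by near=> n; rewrite /= stieltjes_itvoc ?ge0_cp// lee_fin lerB.
have nufin : fin_num_fun nu.
  move=> A mA; rewrite ge0_fin_numE//; apply: le_lt_trans nuT.
  by apply: le_measure; rewrite ?inE.
pose nu' : {finite_measure set (measurableTypeR R) -> \bar R} :=
  HB.pack (lebesgue_stieltjes_measure G)
    (Measure_isFinite.Build _ _ _ (lebesgue_stieltjes_measure G) nufin).
have [h [h0 hfin hint hE]] := @radon_nikodym_sigma_finite _ _ _ lambda nu' stieltjes_dominates.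
exists (fine \o h).
  apply: eq_integrable hint => // x _ /=; by rewrite fineK.
move=> x y xy; rewrite /Rintegral.
have -> : (\int[lambda]_(t in `]x, y]) ((fine \o h) t)%:E = \int[lambda]_(t in `]x, y]) h t)%E.
  by apply: eq_integral => t _ /=; rewrite fineK.
rewrite -hE; last exact: measurable_itv.
by rewrite [nu' _]stieltjes_itvoc.
Unshelve. all: by end_near. Qed.

End cumulative_ac.
End MonotoneDensity.

(** * The fundamental theorem of calculus for absolutely continuous functions *)

Section FTC_AC.
Context {R : realType}.
Implicit Types (a b : R) (F : R -> R).
Notation lambda := (@lebesgue_measure R).

(** Composing F with the projection of the line on [a, b] extends it to a cumulative
    function; the projection does not increase lengths and preserves
    disjointness, so the extension is still absolutely continuous. *)
Lemma ac_nondecreasing_density a b F : a <= b -> absolutely_continuous a b F ->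
  (forall x y, a <= x -> x <= y -> y <= b -> F x <= F y) ->
  exists2 h : R -> R, lambda.-integrable setT (EFin \o h) &
    forall x y, a <= x -> x <= y -> y <= b ->
      F y - F x = \int[lambda]_(t in `]x, y]) h t.
Proof.
move=> ab acF ndF; pose cl x := Num.max a (Num.min x b); pose G x := F (cl x).
have cl_le x y : x <= y -> cl x <= cl y.
  by move=> xy; rewrite /cl ge_max !le_max lexx/= le_min !ge_min xy lexx !orbT.
have cl_itv x : a <= cl x /\ cl x <= b.
  by rewrite /cl le_max lexx ge_max ab ge_min lexx orbT.
have clid x : a <= x -> x <= b -> cl x = x.
  by move=> ax xb; rewrite /cl (min_idPl xb) (max_idPr ax).
have clb x : b <= x -> cl x = b.
  by move=> bx; rewrite /cl (min_idPr bx) (max_idPr ab).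
have cla x : x <= a -> cl x = a.
  by move=> xa; rewrite /cl (min_idPl (le_trans xa ab)) (max_idPl xa).
have cl_dist x y : x <= y -> cl y - cl x <= y - x.
  move=> xy; have [xa|/ltW ax] := leP x a; have [yb|/ltW bY] := leP y b.
  - have [ya|/ltW ay] := leP y a; first by rewrite !cla//; lra.
    by rewrite (cla x)// (clid y)//; lra.
  - by rewrite (cla x)// (clb y)//; lra.
  - by rewrite !clid//; lra.
  - have [xb|/ltW bx] := leP x b; last by rewrite !clb//; lra.
    by rewrite (clb y)// (clid x)//; lra.
have ndG : nondecreasing G.
  move=> x y xy; have [? ?] := cl_itv x; have [? ?] := cl_itv y.
  by rewrite /G; apply: ndF => //; exact: cl_le.
have cG : continuous G.
  move=> x; apply/cvgrPdist_lt => e e0; have [d d0 Hd] := ac_uniform acF e0.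
  have [ax xb] := cl_itv x.
  near=> y; have [ay yb] := cl_itv y.
  have xyd : `|x - y| < d by near: y; exact: (nbhsx_ballx x _ d0).
  have [xy|/ltW yx] := leP x y.
    rewrite distrC; apply: Hd => //; first exact: cl_le.
    rewrite (le_lt_trans (cl_dist _ _ xy))// (le_lt_trans _ xyd)// distrC; exact: ler_norm.
  apply: Hd => //; first exact: cl_le.
  rewrite (le_lt_trans (cl_dist _ _ yx))// (le_lt_trans _ xyd)//; exact: ler_norm.
pose G' : cumulative R R := HB.pack G
  (isCumulative.Build R _ R G ndG (right_continuousW cG)).
have acG (e : R) : 0 < e -> exists2 d : R, 0 < d &
    forall (n : nat) (u v : 'I_n -> R), (forall i, u i <= v i) ->
      trivIset [set: 'I_n] (fun i => `]u i, v i[) ->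
      \sum_(i < n) (v i - u i) < d -> \sum_(i < n) (G' (v i) - G' (u i)) < e.
  move=> e0; have [d d0 Hd] := acF _ e0; exists d => // n u v uv tI sd.
  apply: le_lt_trans (Hd n (cl \o u) (cl \o v) _ _ _).
  - by apply: ler_sum => i _; exact: ler_norm.
  - by move=> i /=; have [? ?] := cl_itv (u i); have [? ?] := cl_itv (v i); rewrite cl_le.
  - move=> i j _ _ [x [/=]]; rewrite !in_itv/= => /andP[x1 x2] /andP[x3 x4].
    have lo z : cl z < x -> x < b -> z < x.
      by move=> + xb; rewrite /cl gt_max gt_min (ltNge b) (ltW xb) orbF => /andP[].
    have hi z : x < cl z -> a < x -> x < z.
      by move=> + ax; rewrite /cl lt_max ltNge (ltW ax)/= lt_min => /andP[].
    have xb : x < b by apply: lt_le_trans x2 _; have [] := cl_itv (v i).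
    have ax : a < x by apply: le_lt_trans x1; have [] := cl_itv (u i).
    apply: tI => //; exists x; split; rewrite /= in_itv /=; apply/andP; split.
    + exact: lo.
    + exact: hi.
    + exact: lo.
    + exact: hi.
  - by apply: le_lt_trans sd; apply: ler_sum => i _; exact: cl_dist.
have cl_b x : b <= x -> G' x = G' b.
  by move=> bx; rewrite /= /G !clb.
have cl_a x : x <= a -> G' x = G' a.
  by move=> xa; rewrite /= /G !cla.
have [h inth hE] := stieltjes_density acG cl_a cl_b.
exists h => // x y ax xy yb; have ay := le_trans ax xy; have xb := le_trans xy yb.
by rewrite -hE// /= /G !clid.
Unshelve. all: by end_near. Qed.

(** Both the variation function and its difference with F are nondecreasing and
    absolutely continuous. *)
Lemma ac_density a b F : a <= b -> absolutely_continuous a b F ->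
  exists2 h : R -> R, lambda.-integrable setT (EFin \o h) &
    forall x y, a <= x -> x <= y -> y <= b ->
      F y - F x = \int[lambda]_(t in `]x, y]) h t.
Proof.
move=> ab acF; pose V := variation_from a F.
have acV := ac_variation_from acF.
have ndV : forall x y, a <= x -> x <= y -> y <= b -> V x <= V y.
  move=> x y ax xy yb.
  rewrite -subr_ge0 (variation_fromB acF)//.
  by rewrite fine_ge0// total_variation_ge0.
have ndVF : forall x y, a <= x -> x <= y -> y <= b -> (V \- F) x <= (V \- F) y.
  move=> x y ax xy yb /=.
  have VE := variation_fromB acF ax xy yb.
  have tvf := ac_tv_fin acF ax xy yb.
  have : `|F y - F x| <= V y - V x.
    by rewrite VE -lee_fin fineK// total_variation_ge.
  by move=> /(le_trans (ler_norm _)); lra.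
have [h1 i1 h1E] := ac_nondecreasing_density ab acV ndV.
have [h2 i2 h2E] := ac_nondecreasing_density ab (ac_sub acV acF) ndVF.
exists (h1 \- h2).
  have -> : EFin \o (h1 \- h2) = ((EFin \o h1) \- (EFin \o h2))%E by [].
  exact: integrableB.
move=> x y ax xy yb; rewrite RintegralB//.
- by rewrite -h1E// -h2E//=; ring.
- exact: integrableS i1.
- exact: integrableS i2.
Qed.

Lemma derivable_near_cstD (F K : R -> R) (c x : R) : derivable K x 1 ->
  (\near x, c + K x = F x) -> derivable F x 1 /\ F^`() x = K^`() x.
Proof.
move=> dK FK; have dc : derivable (cst c : R -> R) x 1 by exact: derivable_cst.
have dH : derivable (cst c \+ K) x 1 by exact: derivableD dc dK.
split; first exact: near_eq_derivable dH.
rewrite !derive1E -(near_eq_derive (1 : R^o) FK).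
rewrite [LHS](_ : _ = 'D_1 (cst c \+ K) x)//.
by rewrite (deriveD dc dK) derive_cst add0r.
Qed.

Lemma ac_derivable_density a b F (h : R -> R) :
  lambda.-integrable setT (EFin \o h) ->
  (forall x y, a <= x -> x <= y -> y <= b ->
      F y - F x = \int[lambda]_(t in `]x, y]) h t) ->
  {ae lambda, forall x, a < x < b -> derivable F x 1 /\ F^`() x = h x}.
Proof.
move=> inth hE.
have loch : locally_integrable [set: R] h.
  by apply: open_integrable_locally => //; exact: openT.
have inth' y : lambda.-integrable [set` Interval (BRight a) (BRight y)] (EFin \o h).
  by apply: integrableS inth => //; exact: measurable_itv.
have := FTC1 inth' loch.
apply: filterS; first exact: (ae_filter_ringOfSetsType lambda).
move=> x Hx /andP[ax xb].
have /Hx[dH HE] : (BRight a < BRight x)%O by rewrite bnd_simp.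
rewrite -HE; apply: (@derivable_near_cstD F _ (F a)) => //.
near=> y; rewrite -hE ?subrKC//; apply: ltW; near: y.
  exact: lt_nbhsr.
exact: lt_nbhsl.
Unshelve. all: by end_near. Qed.

Lemma ac_derivable_ae a b F : a <= b -> absolutely_continuous a b F ->
  {ae lambda, forall x, a < x < b -> derivable F x 1}.
Proof.
move=> ab acF; have [h inth hE] := ac_density ab acF.
have := ac_derivable_density inth hE.
apply: filterS; first exact: (ae_filter_ringOfSetsType lambda).
by move=> x /[apply] -[].
Qed.

(** The integrand g need only agree with the derivative of F where the latter
    exists, and be measurable: this is the form in which the derivative of a
    product with a polynomial is available. *)
Lemma ac_FTC a b F (g : R -> R) : a <= b -> absolutely_continuous a b F ->
  measurable_fun `]a, b] g ->
  {ae lambda, forall x, a < x < b -> derivable F x 1 -> F^`() x = g x} ->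
  forall x y, a <= x -> x <= y -> y <= b ->
    lambda.-integrable `]x, y] (EFin \o g) /\
    \int[lambda]_(t in `]x, y]) g t = F y - F x.
Proof.
move=> ab acF mg Fg x y ax xy yb; have [h inth hE] := ac_density ab acF.
have sub : `]x, y] `<=` `]a, b] by apply: subset_itv; rewrite bnd_simp.
have mh : measurable_fun `]x, y] (EFin \o h).
  by apply: measurable_funS (measurable_int _ inth).
have mg' : measurable_fun `]x, y] (EFin \o g).
  by apply/measurable_EFinP; apply: measurable_funS mg.
have hg : ae_eq lambda `]x, y] (EFin \o h) (EFin \o g).
  have dens := ac_derivable_density inth hE.
  (* The end point b has no two-sided derivative to compare with. *)
  have bn : {ae lambda, forall z : R, z != b}.
    exists [set b]; split; [exact: measurable_set1|exact: lebesgue_measure_set1|].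
    by move=> z /= /negP; rewrite negbK => /eqP.
  move: bn Fg dens; apply: filterS3; first exact: (ae_filter_ringOfSetsType lambda).
  move=> z zb Fgz hz; rewrite /= in_itv/= => /andP[xz zy].
  have azb : a < z < b by rewrite (le_lt_trans ax xz)/= lt_neqAle zb (le_trans zy yb).
  by have [dF <-] := hz azb; rewrite Fgz.
split.
  apply/integrableP; split => //.
  have /integrableP[_] : lambda.-integrable `]x, y] (EFin \o h).
    by apply: integrableS inth.
  apply: le_lt_trans; rewrite le_eqVlt; apply/orP; left; apply/eqP.
  apply: ae_eq_integral; [exact: measurable_itv|exact: measurableT_comp|exact: measurableT_comp|].
  by apply: filterS hg => z /= hgz /hgz [->].
rewrite hE// /Rintegral; congr fine.
by apply/esym/ae_eq_integral => //; exact: measurable_itv.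
Qed.
End FTC_AC.

(** * Square-integrable and essentially bounded functions on [-1, 1] *)

Section L2Pairing.
Context {R : realType}.
Notation lambda := (@lebesgue_measure R).
Notation mu := (mu11 R).
Implicit Types (u v w : R -> R).

Lemma mu11E (A : set R) : mu A = lambda (A `&` `[-1, 1]).
Proof. by []. Qed.

Lemma mu11_itv (A : set R) : A `<=` `[-1, 1] -> mu A = lambda A.
Proof. by move=> A11; rewrite mu11E setIidl. Qed.

Lemma mu11_setT : mu setT = 2%:E.
Proof.
rewrite mu11E setTI lebesgue_measure_itv /= lte_fin.
have -> : -1 < (1 : R) by lra.
by rewrite -EFinB; congr EFin; ring.
Qed.

(** The half-open interval suits the integrals over ]a, b] of the fundamental
    theorem of calculus. *)
Lemma mu11_ae_itv : {ae mu, forall x : R, -1 < x <= 1}.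
Proof.
exists (~` `]-1, 1]); split.
- by apply: measurableC; exact: measurable_itv.
- rewrite mu11E (_ : _ `&` _ = [set -1]) ?lebesgue_measure_set1//.
  apply/seteqP; split=> x /=; rewrite !in_itv/=.
    move=> [/negP]; rewrite negb_and -leNgt -ltNge => /orP[xN /andP[x1 _]|x1 /andP[_ ?]].
      by apply/eqP; rewrite eq_le xN x1.
    lra.
  move=> ->; rewrite ltxx lexx/=; split; first by []. lra.
- by move=> x /= nx; rewrite in_itv.
Qed.

Lemma mu11_integral (D : set R) (f : R -> \bar R) : measurable D -> D `<=` `[-1, 1] ->
  (\int[mu]_(x in D) f x = \int[lambda]_(x in D) f x)%E.
Proof.
by move=> mD D11; apply: eq_measure_integral => A mA AD; apply: mu11_itv; exact: subset_trans D11.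
Qed.

Lemma mu11_Rintegral (D : set R) u : measurable D -> D `<=` `[-1, 1] ->
  \int[mu]_(x in D) u x = \int[lambda]_(x in D) u x.
Proof. by move=> mD D11; rewrite /Rintegral mu11_integral. Qed.

Lemma mu11_Rintegral_split u (x : R) : -1 <= x <= 1 -> mu.-integrable setT (EFin \o u) ->
  \int[mu]_t u t = \int[lambda]_(t in `]-1, x]) u t + \int[lambda]_(t in `]x, 1]) u t.
Proof.
move=> /andP[x1 x2] iu.
have m1 : measurable (`]-1, x] : set R) by exact: measurable_itv.
have m2 : measurable (`]x, 1] : set R) by exact: measurable_itv.
have m : measurable (`]-1, 1] : set R) by exact: measurable_itv.
have UE : `]-1, x] `|` `]x, 1] = `]-1, 1] :> set R.
  by rewrite -itv_bndbnd_setU// bnd_simp.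
rewrite -(mu11_Rintegral u m1) -?(mu11_Rintegral u m2); first last.
- by move=> t /=; rewrite !in_itv/= => /andP[t1 t2]; rewrite (le_trans t2)// ltW.
- move=> t /=; rewrite !in_itv/= => /andP[t1 ->]; rewrite andbT ltW// (le_lt_trans x1)//.
rewrite -Rintegral_setU//; last 2 first.
- by apply: integrableS iu => //; exact: measurableU.
- apply/disj_setPS => t [/=]; rewrite !in_itv/= => /andP[_ tx] /andP[xt _].
  by move: (lt_le_trans xt tx); rewrite ltxx.
rewrite UE /Rintegral; congr fine.
pose D : set (measurableTypeR R) := ~` `]-1, 1].
have mD : measurable D by exact: measurableC.
have D0 : mu D = 0%E.
  have [A [mA A0 sA]] := mu11_ae_itv.
  apply/eqP; rewrite eq_le measure_ge0 andbT -A0; apply: le_measure; rewrite ?inE//.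
have := negligible_integral mD measurableT iu D0.
by rewrite setTD setCK => ->.
Qed.

Notation L2 := (Lfun mu 2%:E).

Definition l2dot u v : R := \int[mu]_t (u t * v t).

Lemma L2_measurable u : u \in L2 -> measurable_fun setT u.
Proof. by move=> /[!inE]/andP[/[!inE]]. Qed.

Lemma l2dot_integrable u v : u \in L2 -> v \in L2 ->
  mu.-integrable setT (EFin \o (fun t => u t * v t)).
Proof. by move=> uL vL; apply/Lfun1_integrable; exact: Lfun2_mul_Lfun1. Qed.

Lemma L2_linear a u v : u \in L2 -> v \in L2 -> (fun t => a * u t + v t) \in L2.
Proof.
have two : (1 <= 2%:E :> \bar R)%E by rewrite lee_fin; lra.
move=> uL vL; rewrite (_ : (fun t => _) = a *: u + v)//.
by have [_] := Lfun_submod_closed mu two; apply.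
Qed.

Lemma L2_0 : cst 0 \in L2.
Proof.
have two : (1 <= 2%:E :> \bar R)%E by rewrite lee_fin; lra.
by have [] := Lfun_submod_closed mu two.
Qed.

Lemma l2dotC u v : l2dot u v = l2dot v u.
Proof. by rewrite /l2dot; apply: eq_Rintegral => t _; rewrite mulrC. Qed.

Lemma l2dot_linear a u v w : u \in L2 -> v \in L2 -> w \in L2 ->
  l2dot (fun t => a * u t + v t) w = a * l2dot u w + l2dot v w.
Proof.
move=> uL vL wL; rewrite /l2dot -RintegralZl//; last exact: l2dot_integrable.
rewrite -RintegralD//.
- by apply: eq_Rintegral => t _; ring.
- have auL : (fun t => a * u t) \in L2.
    have := L2_linear a uL L2_0.
    by rewrite (_ : (fun t => _) = (fun t => a * u t))//; apply/funext => t; rewrite addr0.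
  have := l2dot_integrable auL wL.
  by rewrite (_ : (fun t => _) = (fun t => a * (u t * w t)))//; apply/funext => t; rewrite mulrA.
- exact: l2dot_integrable.
Qed.

Lemma l2dot_ge0 u : 0 <= l2dot u u.
Proof. by apply: Rintegral_ge0 => t _; rewrite -expr2 sqr_ge0. Qed.

Lemma l2dot0 w : l2dot (cst 0) w = 0.
Proof.
by rewrite /l2dot /Rintegral; under eq_integral do rewrite /= mul0r; rewrite integral0.
Qed.

Lemma l2dot_quad a b u v : u \in L2 -> v \in L2 ->
  l2dot (fun t => a * u t + (b * v t)) (fun t => a * u t + (b * v t)) =
  a ^+ 2 * l2dot u u + 2 * a * b * l2dot u v + b ^+ 2 * l2dot v v.
Proof.
move=> uL vL.
have zL := L2_0.
have bvE : (fun t => b * v t) = (fun t => b * v t + cst 0 t) by apply/funext => t; rewrite addr0.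
have bvL : (fun t => b * v t) \in L2 by rewrite bvE L2_linear.
have bvw w : w \in L2 -> l2dot (fun t => b * v t) w = b * l2dot v w.
  by move=> wL; rewrite bvE l2dot_linear// l2dot0 addr0.
have wL := L2_linear a uL bvL.
rewrite l2dot_linear// bvw// ![l2dot _ (fun t => _ + _)]l2dotC !l2dot_linear// !bvw// (l2dotC v u); ring.
Qed.

Lemma discriminant_le (A B C : R) : (forall a b, 0 <= a ^+ 2 * A + 2 * a * b * B + b ^+ 2 * C) ->
  B ^+ 2 <= A * C.
Proof.
move=> H; have C0 : 0 <= C by have := H 0 1; rewrite expr0n/= !mul0r; lra.
have [C0'|Cn0] := eqVneq C 0; last first.
  have Cp : 0 < C by rewrite lt_neqAle eq_sym Cn0.
  have := H C (- B); rewrite (_ : _ + _ = C * (A * C - B ^+ 2)); last by ring.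
  by rewrite pmulr_rge0// subr_ge0.
(* When C = 0 the form is affine in b: a large negative b forces B = 0. *)
have := H B (- (A + 1) / 2); rewrite C0' !mulr0 addr0.
rewrite (_ : _ + _ = - B ^+ 2); last by field.
by rewrite oppr_ge0.
Qed.

Lemma l2dot_CS u v : u \in L2 -> v \in L2 -> l2dot u v ^+ 2 <= l2dot u u * l2dot v v.
Proof. by move=> uL vL; apply: discriminant_le => a b; rewrite -l2dot_quad// l2dot_ge0. Qed.

Lemma l2dot_CS_val u v (a n : R) : u \in L2 -> v \in L2 -> l2dot u v = a -> l2dot v v = n ->
  a ^+ 2 <= l2dot u u * n.
Proof. by move=> uL vL <- <-; exact: l2dot_CS. Qed.

(** In the equality case (v, v) u - (u, v) v has norm zero, hence is orthogonal to
    every w.  Testing against w avoids equalities almost everywhere. *)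
Lemma l2dot_CS_eq u v w : u \in L2 -> v \in L2 -> w \in L2 ->
  l2dot u v ^+ 2 = l2dot u u * l2dot v v -> l2dot v v * l2dot u w = l2dot u v * l2dot v w.
Proof.
move=> uL vL wL E.
pose z t := l2dot v v * u t + (- l2dot u v * v t).
have zz : l2dot z z = 0.
  rewrite l2dot_quad// (_ : _ + _ = l2dot v v * (l2dot u u * l2dot v v - l2dot u v ^+ 2)); last by ring.
  by rewrite E subrr mulr0.
have zL : z \in L2.
  by have := L2_linear 0 uL vL; have := L2_linear (l2dot v v) uL (L2_linear (- l2dot u v - 1) vL vL);
   rewrite (_ : (fun t => _) = z)//; apply/funext => t; rewrite /z; ring.
have := l2dot_CS zL wL; rewrite zz mul0r.
have -> : l2dot z w = l2dot v v * l2dot u w - l2dot u v * l2dot v w.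
  have bvL : (fun t => (- l2dot u v - 1) * v t + v t) \in L2 by exact: L2_linear.
  rewrite (_ : z = (fun t => l2dot v v * u t + ((- l2dot u v - 1) * v t + v t))); last first.
    by apply/funext => t; rewrite /z; ring.
  by rewrite !l2dot_linear//; ring.
move=> h; have /eqP : (l2dot v v * l2dot u w - l2dot u v * l2dot v w) ^+ 2 = 0.
  by apply/eqP; rewrite eq_le h sqr_ge0.
by rewrite sqrf_eq0 subr_eq0 => /eqP.
Qed.

Lemma l2dot_CS_eq_val u v w (a b n : R) : u \in L2 -> v \in L2 -> w \in L2 ->
  l2dot u v = a -> l2dot w v = b -> l2dot v v = n -> a ^+ 2 = l2dot u u * n -> n * l2dot u w = a * b.
Proof. by move=> uL vL wL <- <- <- E; rewrite (l2dotC w v); exact: l2dot_CS_eq. Qed.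

Lemma sobolev0_norm_sqr (r : nat) (f : R -> R) : f^`(r) \in L2 ->
  0 <= sobolev0_norm r f /\ sobolev0_norm r f ^+ 2 = l2dot f^`(r) f^`(r).
Proof.
move=> fL; rewrite /sobolev0_norm; set N := Lnorm _ _ _.
have N0 : (0 <= N)%E by exact: Lnorm_ge0.
have Nfin : N \is a fin_num.
  by move: fL; rewrite inE => /andP[_]; rewrite inE /= /finite_norm ge0_fin_numE.
split; first exact: fine_ge0.
have two : (2 : R) != 0 by [].
have := powR_Lnorm mu (EFin \o f^`(r)) two.
rewrite -/N -(fineK Nfin) poweR_EFin.
rewrite powR_mulrn ?fine_ge0// => /(congr1 fine) /= ->.
rewrite /l2dot /Rintegral; congr fine; apply: eq_integral => t _ /=.
by rewrite powR_mulrn// real_normK ?num_real// expr2.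
Qed.

Lemma mu11_sup_le (g : R -> R) (C : R) : (forall x, -1 <= x <= 1 -> `|g x| <= C) ->
  ('N[mu]_+oo [EFin \o g] <= C%:E)%E.
Proof.
move=> gC; rewrite unlock /Lnorm mu11_setT lte_fin ltr0n /=.
apply/ess_supP; move: mu11_ae_itv; apply: filterS; first exact: (ae_filter_ringOfSetsType mu).
by move=> x /andP[x1 x2] /=; rewrite lee_fin gC// x2 andbT ltW.
Qed.

(** A continuous function that exceeds a bound at a point of [-1, 1] exceeds it on
    an interval of positive measure. *)
Lemma mu11_le_sup (g : R -> R) : absolutely_continuous (-1) 1 g ->
  ('N[mu]_+oo [EFin \o g] < +oo)%E ->
  forall x, -1 <= x <= 1 -> `|g x| <= fine ('N[mu]_+oo [EFin \o g])%E.
Proof.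
move=> acg; set N := ('N[_]_ _[_])%E => Nfin.
have N0 : (0 <= N)%E by exact: Lnorm_ge0.
have {}Nfin : N \is a fin_num by rewrite ge0_fin_numE.
have aeN : {ae mu, forall x, `|g x| <= fine N}.
  have /ess_supP : (ess_sup mu (abse \o (EFin \o g)) <= N)%E.
    by rewrite /N unlock /Lnorm mu11_setT lte_fin ltr0n.
  apply: (@filterS _ _ (ae_filter_ringOfSetsType mu)).
  by move=> x /=; rewrite -{1}(fineK Nfin) lee_fin.
move=> x /andP[x1 x2]; rewrite leNgt; apply/negP => gx.
have e0 : 0 < `|g x| - fine N by rewrite subr_gt0.
have [d d0 Hd] := ac_uniform acg e0.
have near_gt y : -1 <= y <= 1 -> `|y - x| < d -> fine N < `|g y|.
  move=> /andP[y1 y2] yx.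
  have : `|g y - g x| < `|g x| - fine N.
    have [xy|/ltW xy] := leP x y.
      by apply: Hd => //; rewrite (le_lt_trans _ yx)// ler_norm.
    by rewrite distrC; apply: Hd => //; rewrite (le_lt_trans _ yx)// distrC ler_norm.
  have := ler_normD (g x - g y) (g y); rewrite subrK distrC; lra.
pose a := Num.max (-1) (x - d / 2); pose b := Num.min 1 (x + d / 2).
have ab : a < b.
  by rewrite /a /b gt_max !lt_min; apply/andP; split; apply/andP; split; lra.
have sub y : a < y -> y < b -> -1 <= y <= 1 /\ `|y - x| < d.
  rewrite /a /b gt_max lt_min => /andP[h1 h2] /andP[h3 h4].
  by split; [apply/andP; split; lra|rewrite ltr_norml; apply/andP; split; lra].
have [A [mA A0 sA]] := aeN.
have : (lambda `]a, b[ <= 0)%E.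
  rewrite -A0 -mu11_itv; last first.
    by move=> y /=; rewrite !in_itv/= => /andP[h1 h2]; have [] := sub y h1 h2.
  apply: le_measure; rewrite ?inE//.
  move=> y /=; rewrite in_itv/= => /andP[h1 h2]; have [h3 h4] := sub y h1 h2.
  by apply: (sA y) => /=; apply/negP; rewrite -ltNge near_gt.
by rewrite lebesgue_measure_itv /= lte_fin ab -EFinB lee_fin leNgt subr_gt0 ab.
Qed.

End L2Pairing.

(** * Splines with one interior knot *)

Section Splines.
Context {R : realType}.
Notation lambda := (@lebesgue_measure R).
Notation mu := (mu11 R).
Notation L2 := (Lfun mu 2%:E).
Implicit Types (f : R -> R) (p P Q : {poly R}).

(** Every difference quotient of f at t is one of F1 or of F2, and both families
    converge to l.  This covers the knots of a spline and its other points at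
    once. *)
Lemma is_derive_two_sided f (F1 F2 : R -> R) (t l : R) :
  is_derive t 1 F1 l -> is_derive t 1 F2 l -> F1 t = f t -> F2 t = f t ->
  (\forall y \near t, f y = F1 y \/ f y = F2 y) -> is_derive t 1 f l.
Proof.
move=> [d1 E1] [d2 E2] F1t F2t fF.
suff cv : h^-1 *: ((f \o shift t) (h *: (1 : R)) - f t) @[h --> 0^'] --> (l : R).
  by split; [apply/cvg_ex; exists l|exact: cvg_lim].
move: d1 d2; rewrite /derivable => d1 d2.
have c1 : h^-1 *: ((F1 \o shift t) (h *: (1 : R)) - F1 t) @[h --> 0^'] --> (l : R).
  by rewrite -E1.
have c2 : h^-1 *: ((F2 \o shift t) (h *: (1 : R)) - F2 t) @[h --> 0^'] --> (l : R).
  by rewrite -E2.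
apply/cvgrPdist_lt => e e0.
move/cvgrPdist_lt : c1 => /(_ e e0) n1; move/cvgrPdist_lt : c2 => /(_ e e0) n2.
have nf : \forall h \near (0 : R)^', f (h + t) = F1 (h + t) \/ f (h + t) = F2 (h + t).
  apply: nbhs_dnbhs.
  have ct : (h + t) @[h --> (0 : R)] --> t.
    by rewrite -[X in _ --> X]add0r; apply: cvgD; [exact: cvg_id|exact: cvg_cst].
  exact: (ct _ fF).
near=> h.
have [] : f (h + t) = F1 (h + t) \/ f (h + t) = F2 (h + t) by near: h.
- by rewrite /= [h *: _]mulr1 => ->; rewrite -F1t;
  have : `|l - h^-1 *: ((F1 \o shift t) (h *: (1 : R)) - F1 t)| < e by [near: h]; rewrite /= [h *: _]mulr1.
- by rewrite /= [h *: _]mulr1 => ->; rewrite -F2t;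
  have : `|l - h^-1 *: ((F2 \o shift t) (h *: (1 : R)) - F2 t)| < e by [near: h]; rewrite /= [h *: _]mulr1.
Unshelve. all: by end_near. Qed.

(** The knot x belongs to the left piece, in accordance with the intervals ]-1, x]
    and ]x, 1] of integration. *)
Definition spline (x : R) P Q (t : R) : R :=
  if (-1 <= t <= 1) then (if t <= x then P.[t] else Q.[t]) else 0.

(** At a knot the value and the derivative of the two adjacent polynomials must
    match; the polynomial outside [-1, 1] is 0. *)
Lemma is_derive_spline (x : R) P Q (t : R) : -1 < x < 1 ->
  (t = -1 -> P.[-1] = 0 /\ (deriv P).[-1] = 0) ->
  (t = 1 -> Q.[1] = 0 /\ (deriv Q).[1] = 0) ->
  (t = x -> P.[x] = Q.[x] /\ (deriv P).[x] = (deriv Q).[x]) ->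
  is_derive t 1 (spline x P Q) (spline x (deriv P) (deriv Q) t).
Proof.
move=> /andP[x1 x2] tN1 tp1 tx.
have H (A B : {poly R}) : A.[t] = spline x P Q t -> B.[t] = spline x P Q t ->
    (deriv A).[t] = spline x (deriv P) (deriv Q) t ->
    (deriv B).[t] = spline x (deriv P) (deriv Q) t ->
    (\forall y \near t, spline x P Q y = A.[y] \/ spline x P Q y = B.[y]) ->
    is_derive t 1 (spline x P Q) (spline x (deriv P) (deriv Q) t).
  move=> At Bt dAt dBt; apply: is_derive_two_sided => //.
    by rewrite -dAt; exact: is_derive_poly.
  by rewrite -dBt; exact: is_derive_poly.
have sm : (-1 : R) <= 1 by lra.
have [t1|t1|t1] := ltgtP t (-1); last 1 first.
- have [P1 dP1] := tN1 t1; subst t; apply: (H P 0); rewrite ?deriv0 ?horner0 /spline ?lexx ?sm ?(ltW x1)//.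
  near=> y; rewrite horner0; case: ifP; last by right.
  by left; rewrite ltW//; near: y; exact: lt_nbhsl.
- apply: (H 0 0); rewrite ?deriv0 ?horner0 /spline ?leNgt ?t1//.
  near=> y; left; rewrite horner0 ifF// leNgt.
  have -> : y < -1 by near: y; exact: lt_nbhsl.
  by [].
- have [t2|t2|t2] := ltgtP t 1; last 1 first.
  + have [Q1 dQ1] := tp1 t2; subst t; have n1x : (1 <= x) = false by rewrite leNgt x2.
    apply: (H Q 0); rewrite ?deriv0 ?horner0 /spline ?lexx ?sm ?n1x//.
    near=> y; rewrite horner0; case: ifP; last by right.
    left; rewrite leNgt (_ : x < y)//; near: y; exact: lt_nbhsr.
  + have spE p q : spline x p q t = if t <= x then p.[t] else q.[t].
      by rewrite /spline (ltW t1) (ltW t2).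
    have near_in : \forall y \near t, -1 <= y <= 1.
      near=> y.
      have -> : -1 <= y by apply: ltW; near: y; exact: lt_nbhsr.
      by apply: ltW; near: y; exact: lt_nbhsl.
    have [tx'|tx'|tx'] := ltgtP t x.
    * apply: (H P P); rewrite ?spE ?ltW//.
      near=> y; left; rewrite /spline ifT; last by near: y.
      by rewrite ltW//; near: y; exact: lt_nbhsl.
    * apply: (H Q Q); rewrite ?spE ?leNgt ?tx'//.
      near=> y; left; rewrite /spline ifT; last by near: y.
      by rewrite leNgt (_ : x < y)//; near: y; exact: lt_nbhsr.
    * have [PQ dPQ] := tx tx'; have near_x := near_in; rewrite tx' in near_x.
      apply: (H P Q); rewrite ?spE ?tx' ?lexx//.
      near=> y; rewrite /spline ifT; last by near: y.
      by case: ifP; [left|right].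
  + apply: (H 0 0); rewrite ?deriv0 ?horner0 /spline ?(leNgt t 1) ?t2 ?andbF//.
    near=> y; left; rewrite horner0 ifF// andbC leNgt.
    have -> : 1 < y by near: y; exact: lt_nbhsr.
    by [].
Unshelve. all: by end_near. Qed.

Lemma poly_bounded p : exists2 C, 0 <= C & forall t, -1 <= t <= 1 -> `|p.[t]| <= C.
Proof.
elim/poly_ind: p => [|p c [C C0 HC]]; first by exists 0 => // t _; rewrite horner0 normr0.
exists (C + `|c|); first by rewrite addr_ge0.
move=> t t11; rewrite hornerMXaddC (le_trans (ler_normD _ _))// lerD2r normrM.
by rewrite -[leRHS]mulr1 ler_pM ?HC// ler_norml.
Qed.

Lemma poly_lipschitz p : exists2 C, 0 <= C & forall s t, -1 <= s -> s <= t -> t <= 1 ->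
  `|p.[t] - p.[s]| <= C * (t - s).
Proof.
have [C C0 HC] := poly_bounded (deriv p); exists C => // s t s1.
rewrite le_eqVlt => /predU1P[->|st] t1; first by rewrite !subrr normr0 mulr0.
have [c /andP[sc ct] ->] := poly_MVT p st.
rewrite normrM [`|t - s|]gtr0_norm ?subr_gt0//.
rewrite ler_wpM2r//; first by rewrite subr_ge0 ltW.
by rewrite HC// (ltW (le_lt_trans s1 sc)) (ltW (lt_le_trans ct t1)).
Qed.

Lemma lipschitz_ac (a b C : R) f : 0 <= C ->
  (forall s t, a <= s -> s <= t -> t <= b -> `|f t - f s| <= C * (t - s)) ->
  absolutely_continuous a b f.
Proof.
move=> C0 H e e0; exists (e / (C + 1)); first by rewrite divr_gt0// ltr_wpDl.
move=> n u v uv _ sd; apply: (@le_lt_trans _ _ (\sum_(i < n) (C + 1) * (v i - u i))).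
  apply: ler_sum => i _; have [? [uvi ?]] := uv i.
  by apply: le_trans (H _ _ _ _ _) _ => //; rewrite ler_wpM2r ?subr_ge0// lerDl.
by rewrite -mulr_sumr mulrC -ltr_pdivlMr// ltr_wpDl.
Qed.

Lemma L2_bounded f (C : R) : measurable_fun setT f -> (forall t, `|f t| <= C) -> f \in L2.
Proof.
move=> mf fC; have C0 : 0 <= C by rewrite (le_trans (normr_ge0 (f 0))).
rewrite inE; apply/andP; split; rewrite inE //= /finite_norm unlock /Lnorm.
apply: poweR_lty; apply: (@le_lt_trans _ _ (\int[mu]_t (C ^+ 2)%:E)%E).
  apply: ge0_le_integral => //.
  - by move=> t _; rewrite lee_fin powR_ge0.
  - apply/measurable_EFinP; apply: (measurableT_comp (measurable_powR _)) => //.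
    exact: measurableT_comp.
  - move=> t _ /=; rewrite lee_fin powR_mulrn//; rewrite lerXn2r ?nnegrE//.
by rewrite integral_cst// mu11_setT -EFinM ltry.
Qed.

Section spline_class.
Variables (r : nat) (x : R) (P Q : {poly R}).
Hypothesis x11 : -1 < x < 1.
Hypothesis r0 : (0 < r)%N.
Hypothesis P1 : forall j, (j < r)%N -> (derivn j P).[-1] = 0.
Hypothesis Q1 : forall j, (j < r)%N -> (derivn j Q).[1] = 0.
Hypothesis PQx : forall j, (j < r)%N -> (derivn j P).[x] = (derivn j Q).[x].
Let g := spline x P Q.

Lemma is_derive_derivn_spline j (t : R) : (j.+1 < r)%N ->
  is_derive t 1 (spline x (derivn j P) (derivn j Q)) (spline x (derivn j.+1 P) (derivn j.+1 Q) t).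
Proof.
move=> jr; rewrite !derivnS; have jr' := ltnW jr.
by apply: is_derive_spline => //; rewrite -!derivnS; auto.
Qed.

Lemma derive1n_spline j : (j < r)%N -> g^`(j) = spline x (derivn j P) (derivn j Q).
Proof.
elim: j => [_|j IH jr]; first by rewrite derive1n0.
rewrite derive1nS (IH (ltnW jr)); apply/funext => t; rewrite derive1E.
by have := is_derive_derivn_spline t jr => -[].
Qed.

Lemma spline_lipschitz P' Q' : P'.[x] = Q'.[x] -> exists2 C, 0 <= C &
  forall s t, -1 <= s -> s <= t -> t <= 1 ->
    `|spline x P' Q' t - spline x P' Q' s| <= C * (t - s).
Proof.
move=> PQ'; have [C1 C10 H1] := poly_lipschitz P'; have [C2 C20 H2] := poly_lipschitz Q'.
exists (C1 + C2); first by rewrite addr_ge0.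
move=> s t s1 st t1; rewrite /spline s1 t1 (le_trans st t1) (le_trans s1 st) /=.
have [tx|xt] := leP t x.
  rewrite (le_trans st tx) (le_trans (H1 _ _ s1 st t1))//.
  by rewrite ler_wpM2r ?subr_ge0// lerDl.
have [sx|xs] := leP s x; last first.
  by rewrite (le_trans (H2 _ _ s1 st t1))// ler_wpM2r ?subr_ge0// lerDr.
have /andP[x1 x2] := x11.
have := H1 _ _ s1 sx (ltW x2); have := H2 _ _ (ltW x1) (ltW xt) t1.
have := ler_normD (Q'.[t] - Q'.[x]) (P'.[x] - P'.[s]).
rewrite PQ' addrA subrK => h1 h2 h3; apply: le_trans h1 _.
have : C2 * (t - x) <= C2 * (t - s) by rewrite ler_wpM2l//; lra.
have : C1 * (x - s) <= C1 * (t - s) by rewrite ler_wpM2l//; lra.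
by rewrite mulrDl; lra.
Qed.

Lemma ac_derive1n_spline j : (j < r)%N -> absolutely_continuous (-1) 1 g^`(j).
Proof.
move=> jr; rewrite derive1n_spline//.
have [C C0 HC] := spline_lipschitz (PQx jr); exact: lipschitz_ac C0 HC.
Qed.

Lemma derive1n_spline_top t : t != -1 -> t != x -> t != 1 ->
  g^`(r) t = spline x (derivn r P) (derivn r Q) t.
Proof.
move=> tN1 tx t1; have r1 : (r.-1 < r)%N by rewrite prednK.
rewrite -(prednK r0) derive1nS (derive1n_spline r1) !derivnS derive1E.
have : is_derive t 1 (spline x (derivn r.-1 P) (derivn r.-1 Q))
   (spline x (deriv (derivn r.-1 P)) (deriv (derivn r.-1 Q)) t).
  by apply: is_derive_spline => // /eqP; rewrite ?(negbTE tN1) ?(negbTE tx) ?(negbTE t1).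
by case.
Qed.

Lemma spline_bounded P' Q' : exists2 C, 0 <= C & forall t, `|spline x P' Q' t| <= C.
Proof.
have [C1 C10 H1] := poly_bounded P'; have [C2 C20 H2] := poly_bounded Q'.
exists (C1 + C2) => [|t]; first exact: addr_ge0.
rewrite /spline; case: ifP => [t11|_]; last by rewrite normr0 addr_ge0.
by case: ifP => _; [rewrite (le_trans (H1 _ t11)) ?lerDl|rewrite (le_trans (H2 _ t11)) ?lerDr].
Qed.

Lemma measurable_spline P' Q' : measurable_fun setT (spline x P' Q').
Proof.
have mh (p : {poly R}) : measurable_fun setT (horner p).
  by apply: continuous_measurable_fun; exact: continuous_horner.
apply: measurable_fun_ifT => //.
  by apply: measurable_and; apply: measurable_fun_ler.
by apply: measurable_fun_ifT => //; apply: measurable_fun_ler.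
Qed.

(** The derivative of order r agrees with a spline except at the three knots, and
    finitely many points do not affect measurability and boundedness. *)
Lemma L2_derive1n_spline : g^`(r) \in L2.
Proof.
pose S := spline x (derivn r P) (derivn r Q).
have gE : g^`(r) = fun t => if t == -1 then g^`(r) (-1) else
    if t == x then g^`(r) x else if t == 1 then g^`(r) 1 else S t.
  apply/funext => t; case: eqP => [->//|/eqP tN1]; case: eqP => [->//|/eqP tx].
  by case: eqP => [->//|/eqP t1]; exact: derive1n_spline_top.
have [C C0 SC] := spline_bounded (derivn r P) (derivn r Q).
apply: (@L2_bounded _ (`|g^`(r) (-1)| + `|g^`(r) x| + `|g^`(r) 1| + C)).
- rewrite gE; do 3 (apply: measurable_fun_ifT => //; first exact: measurable_fun_eqr).
  exact: measurable_spline.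
- have sum4 (a b c d : R) : 0 <= a -> 0 <= b -> 0 <= c -> 0 <= d ->
      [/\ a <= a + b + c + d, b <= a + b + c + d, c <= a + b + c + d & d <= a + b + c + d].
    by move=> *; split; lra.
  have [h1 h2 h3 h4] := sum4 _ _ _ _ (normr_ge0 (g^`(r) (-1)))
    (normr_ge0 (g^`(r) x)) (normr_ge0 (g^`(r) 1)) C0.
  move=> t; rewrite {1}gE; case: ifP => _ //; case: ifP => _ //; case: ifP => _ //.
  exact: le_trans (SC t) h4.
Qed.

Lemma spline_sobolev0 : sobolev0 r g.
Proof.
have /andP[x1 x2] := x11; split.
- by move=> t nt; rewrite /g /spline (negbTE nt).
- move=> j jr t _; rewrite (derive1n_spline (ltnW jr)).
  by have [] := is_derive_derivn_spline t jr.
- exact: ac_derive1n_spline.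
- exact: L2_derive1n_spline.
- move=> j jr; rewrite derive1n_spline// /spline !lexx (ltW x1) (leNgt 1 x) x2 /=.
  have -> : -1 <= 1 :> R by lra.
  by rewrite /= P1 ?Q1.
Qed.

End spline_class.
End Splines.

(** * Representation of the derivatives at a point *)

Section Pairing.
Context {R : realType}.
Notation lambda := (@lebesgue_measure R).
Notation mu := (mu11 R).
Notation L2 := (Lfun mu 2%:E).
Implicit Types (f : R -> R) (p P Q : {poly R}).

Lemma ac_cst (a b c : R) : absolutely_continuous a b (cst c).
Proof. by apply: (@lipschitz_ac _ _ _ 0) => // s t _ _ _; rewrite subrr normr0 mul0r. Qed.

Lemma ac_add (a b : R) (F G : R -> R) : absolutely_continuous a b F ->
  absolutely_continuous a b G -> absolutely_continuous a b (fun t => F t + G t).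
Proof.
move=> acF acG.
rewrite (_ : (fun t => _) = F \- (cst 0 \- G)); first exact/ac_sub/ac_sub/acG/ac_cst.
by apply/funext => t /=; rewrite sub0r opprK.
Qed.

Lemma ac_bounded (a b : R) (F : R -> R) : a <= b -> absolutely_continuous a b F ->
  exists2 C, 0 <= C & forall t, a <= t <= b -> `|F t| <= C.
Proof.
move=> ab acF; exists (`|F a| + variation_from a F b).
  by rewrite addr_ge0// fine_ge0// total_variation_ge0.
move=> t /andP[at_ tb].
have -> : F t = F a + (F t - F a) by rewrite subrKC.
rewrite (le_trans (ler_normD _ _))// lerD2l.
have tvt := ac_tv_fin acF (lexx a) at_ tb.
apply: (@le_trans _ _ (variation_from a F t)).
  by rewrite -lee_fin fineK// total_variation_ge.
rewrite -subr_ge0 (variation_fromB acF)// fine_ge0// total_variation_ge0//.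
Qed.

Lemma ac_mul (a b : R) (F G : R -> R) : a <= b -> absolutely_continuous a b F ->
  absolutely_continuous a b G -> absolutely_continuous a b (fun t => F t * G t).
Proof.
move=> ab acF acG e e0.
have [C C0 FC] := ac_bounded ab acF; have [D D0 GD] := ac_bounded ab acG.
pose M := C + D + 1.
have M0 : 0 < M by rewrite /M ltr_wpDl// addr_ge0.
have eM : 0 < e / 2 / M by rewrite !divr_gt0.
have [d1 d10 H1] := acF _ eM; have [d2 d20 H2] := acG _ eM.
exists (Num.min d1 d2); first by rewrite lt_min d10.
move=> n u v uv tI; rewrite lt_min => /andP[s1 s2].
have h1 := H1 n u v uv tI s1; have h2 := H2 n u v uv tI s2.
apply: (@le_lt_trans _ _ (M * (\sum_(i < n) `|F (v i) - F (u i)|) +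
                           M * (\sum_(i < n) `|G (v i) - G (u i)|))); last first.
  rewrite (splitr e); apply: ltrD.
    by rewrite mulrC -ltr_pdivlMr.
  by rewrite mulrC -ltr_pdivlMr.
rewrite !mulr_sumr -big_split/=; apply: ler_sum => i _.
have [au [uvi vb]] := uv i.
have -> : F (v i) * G (v i) - F (u i) * G (u i) =
   (F (v i) - F (u i)) * G (v i) + F (u i) * (G (v i) - G (u i)) by ring.
rewrite (le_trans (ler_normD _ _))// !normrM lerD//.
  rewrite mulrC ler_wpM2r// (le_trans (GD _ _)) ?vb ?(le_trans au)// /M; lra.
rewrite ler_wpM2r// (le_trans (FC _ _)) ?au ?(le_trans uvi)// /M; lra.
Qed.

Lemma ac_horner p : absolutely_continuous (-1) 1 (horner p).
Proof. by have [C C0 HC] := poly_lipschitz p; exact: lipschitz_ac C0 HC. Qed.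

Lemma measurable_horner (D : set R) p : measurable_fun D (horner p).
Proof.
apply: measurable_funTS; apply: continuous_measurable_fun; exact: continuous_horner.
Qed.

(** Boundary terms of n integrations by parts, taken as a function of the end
    point.  Its derivative is computed directly, so that the fundamental theorem
    of calculus is applied only once. *)
Definition parts_sum (r : nat) f p n (t : R) : R :=
  \sum_(j < n) derive1n (r - j.+1) f t * ((-1) ^+ j *: derivn j p).[t].

Section by_parts.
Variables (r : nat) (f : R -> R) (p : {poly R}).
Hypothesis r0 : (0 < r)%N.
Hypothesis fS : sobolev0 r f.
Hypothesis pr : (size p <= r)%N.

Let q j : {poly R} := (-1) ^+ j *: derivn j p.
Let Phi := parts_sum r f p.

Let deriv_q j : deriv (q j) = - q j.+1.
Proof. by rewrite /q derivZ -derivnS exprS mulN1r scaleNr opprK. Qed.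

Let qr : q r = 0.
Proof.
rewrite /q (_ : derivn r p = 0) ?scaler0//.
apply/polyP => i; rewrite coef_derivn coef0.
by move/leq_sizeP : pr => ->; [rewrite mul0rn|rewrite leq_addr].
Qed.

Lemma sobolev0_is_derive j t : (j < r)%N -> -1 < t < 1 ->
  derivable (derive1n r.-1 f) t 1 -> is_derive t 1 (derive1n j f) ((derive1n j.+1 f) t).
Proof.
case: fS => _ df _ _ _; move=> jr /andP[t1 t2] dt.
rewrite derive1nS derive1E; apply: derivableP.
have [jr'|] := ltnP j.+1 r; first by apply: df; rewrite ?ltW.
by move=> rj; have -> : j = r.-1 by lia.
Qed.

Let is_derive_Phi n t : (n <= r)%N -> -1 < t < 1 -> derivable (derive1n r.-1 f) t 1 ->
  is_derive t 1 (Phi n) ((derive1n r f) t * p.[t] - (derive1n (r - n) f) t * (q n).[t]).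
Proof.
move=> nr t11 dt; elim: n nr => [_|n IH nr].
  rewrite subn0 /q expr0 scale1r subrr.
  rewrite (_ : Phi 0 = cst 0); first exact: is_derive_cst.
  by apply/funext => z; rewrite /Phi /parts_sum big_ord0.
have PhiS : Phi n.+1 = Phi n \+ (fun z => (derive1n (r - n.+1) f) z * (q n).[z]).
  by apply/funext => z; rewrite /Phi /parts_sum big_ord_recr.
have rn : (r - n = (r - n.+1).+1)%N by lia.
have d1 : is_derive t 1 (derive1n (r - n.+1) f) ((derive1n (r - n) f) t).
  by rewrite rn; apply: sobolev0_is_derive => //; lia.
have d2 := is_derive_poly (q n) t.
have D := is_deriveD (IH (ltnW nr)) (is_deriveM d1 d2).
rewrite PhiS; apply: (is_derive_eq D).
rewrite /GRing.scale /= deriv_q hornerN; ring.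
Qed.

Let ac_Phi n : (n <= r)%N -> absolutely_continuous (-1) 1 (Phi n).
Proof.
case: fS => _ _ acf _ _.
elim: n => [_|n IH nr].
  rewrite (_ : Phi 0 = cst 0); first exact: ac_cst.
  by apply/funext => z; rewrite /Phi /parts_sum big_ord0.
rewrite (_ : Phi n.+1 = fun z => Phi n z + (derive1n (r - n.+1) f) z * (q n).[z]); last first.
  by apply/funext => z; rewrite /Phi /parts_sum big_ord_recr.
apply: ac_add; first exact/IH/ltnW.
apply: ac_mul; [by lra|by apply: acf; lia|exact: ac_horner].
Qed.

(** The derivative of the boundary terms telescopes to f^(r) p, because p has
    degree < r and so no term is left at the other end.  Only f^(r-1) may fail to
    be derivable, on a null set. *)
Lemma sobolev0_by_parts (a b : R) : -1 <= a -> a <= b -> b <= 1 ->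
  \int[lambda]_(t in `]a, b]) ((derive1n r f) t * p.[t]) = Phi r b - Phi r a.
Proof.
move=> a1 ab b1; case: (fS) => _ _ acf fL _.
have N11 : -1 <= 1 :> R by lra.
have mg : measurable_fun (`]-1, 1] : set R) (fun t : R => (derive1n r f) t * p.[t]).
  apply: measurable_funM; last exact: measurable_horner.
  by apply: measurable_funTS; exact: L2_measurable.
have Pg : {ae lambda, forall t : R, -1 < t < 1 -> derivable (Phi r) t 1 ->
    (Phi r)^`() t = (derive1n r f) t * p.[t]}.
  have acr : absolutely_continuous (-1) 1 (derive1n r.-1 f) by apply: acf; rewrite prednK.
  have := ac_derivable_ae N11 acr.
  apply: filterS; first exact: (ae_filter_ringOfSetsType lambda).
  move=> t /[swap] t11 /(_ t11) dt _; rewrite derive1E.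
  have [_ ->] := is_derive_Phi (leqnn r) t11 dt.
  by rewrite qr horner0 mulr0 subr0.
exact: (ac_FTC N11 (ac_Phi (leqnn r)) mg Pg a1 ab b1).2.
Qed.

Lemma parts_sum_end (t : R) : t = -1 \/ t = 1 -> parts_sum r f p r t = 0.
Proof.
case: fS => _ _ _ _ fe tE; rewrite /parts_sum big1// => j _.
have rj : (r - j.+1 < r)%N by rewrite ltn_subrL.
have [f1 f2] := fe _ rj.
by case: tE => ->; rewrite ?f1 ?f2 mul0r.
Qed.
End by_parts.

Section representation.
Variables (s k : nat) (x : R) (P Q : {poly R}).
Let r := (s + k).+1.
Hypothesis x11 : -1 < x < 1.
Hypothesis P1 : forall j, (j < r)%N -> (derivn j P).[-1] = 0.
Hypothesis Q1 : forall j, (j < r)%N -> (derivn j Q).[1] = 0.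
Hypothesis PQ : P - Q = (-1) ^+ r *: taylor_ker x (s + r).
Let g := spline x P Q.

Lemma derivn_taylor_ker i j : derivn i (taylor_ker x (i + j)) = (-1) ^+ i *: taylor_ker x j.
Proof.
elim: i => [|i IH]; first by rewrite derivn0 scale1r.
rewrite derivSn addSn deriv_taylor_ker derivnN IH exprS mulN1r scaleNr//.
Qed.

Lemma taylor_ker_atE j : (taylor_ker x j).[x] = (j == 0%N)%:R.
Proof. by case: j => [|j]; rewrite ?taylor_ker0 ?hornerC ?taylor_ker_at. Qed.

(** The two pieces differ by a multiple of (x - X)^(s + r), so their derivatives
    agree at the knot up to the order s + r - 1, which is at least r - 1 and at
    least k. *)
Lemma green_matching j : (j <= s + r)%N ->
  (derivn j P).[x] - (derivn j Q).[x] = ((-1) ^+ (r + j)) * (j == (s + r)%N)%:R.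
Proof.
move=> js; rewrite -hornerN -hornerD -derivnB PQ derivnZ.
rewrite -{1}(subnKC js) derivn_taylor_ker scalerA -exprD hornerZ taylor_ker_atE.
by congr (_ * _%:R); rewrite subn_eq0 eqn_leq js.
Qed.

Lemma green_matching_lt j : (j < r)%N -> (derivn j P).[x] = (derivn j Q).[x].
Proof.
move=> jr; have jsr : (j < s + r)%N := leq_trans jr (leq_addl s r).
by apply/eqP; rewrite -subr_eq0 green_matching ?(ltnW jsr)// ltn_eqF ?mulr0.
Qed.

Lemma green_sobolev0 : sobolev0 r g.
Proof. exact (@spline_sobolev0 R r x P Q x11 isT P1 Q1 green_matching_lt). Qed.

Lemma green_L2 : (derive1n r g) \in L2. Proof. by case: green_sobolev0. Qed.

Lemma green_at : (derive1n k g) x = (derivn k P).[x].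
Proof.
rewrite (derive1n_spline x11 P1 Q1 green_matching_lt); last by rewrite ltnS leq_addl.
by have /andP[/ltW x1 /ltW x2] := x11; rewrite /spline x1 x2 lexx.
Qed.

Hypothesis szP : (size (derivn r P) <= r)%N.
Hypothesis szQ : (size (derivn r Q) <= r)%N.

(** Integrating by parts on both sides of x leaves the boundary terms at x, with
    the jumps of the derivatives of (P - Q)^(r) = (x - X)^s / s!.  Only the jump
    of order s is nonzero, and it multiplies f^(r-1-s) = f^(k). *)
Lemma green_representation f : sobolev0 r f ->
  l2dot (derive1n r f) (derive1n r g) = derive1n k f x.
Proof.
move=> fS; have fL : (derive1n r f) \in L2 by case: fS.
have /andP[x1 x2] := x11.
rewrite /l2dot (@mu11_Rintegral_split _ _ x); last 2 first.
- by rewrite !ltW.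
- exact: l2dot_integrable green_L2.
have mf (D : set R) : measurable_fun D (derive1n r f) by apply: measurable_funTS; exact: L2_measurable.
have mg (D : set R) : measurable_fun D (derive1n r g).
  by apply: measurable_funTS; apply: L2_measurable; exact: green_L2.
have ae_top : {ae lambda, forall t, (derive1n r g) t = spline x (derivn r P) (derivn r Q) t}.
  exists [set -1; x; 1]; split.
  - by do 2 apply: measurableU => //; exact: measurable_set1.
  - apply: countable_lebesgue_measure0; apply: finite_set_countable.
    by rewrite !finite_setU; do !split; exact: finite_set1.
  - move=> t /=; apply: contra_notP => h.
    apply: (@derive1n_spline_top R r x P Q x11 isT P1 Q1 green_matching_lt).
    + by apply/eqP => E; apply: h; left; left.
    + by apply/eqP => E; apply: h; left; right.
    + by apply/eqP => E; apply: h; right.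
have on_piece (A : {poly R}) (D : set R) : measurable D ->
    (forall t, D t -> spline x (derivn r P) (derivn r Q) t = A.[t]) ->
    \int[lambda]_(t in D) ((derive1n r f) t * (derive1n r g) t) = \int[lambda]_(t in D) ((derive1n r f) t * A.[t]).
  move=> mD DA; rewrite /Rintegral; congr fine; apply: ae_eq_integral => //.
  - by apply/measurable_EFinP; apply: measurable_funM; [exact: mf|exact: mg].
  - by apply/measurable_EFinP; apply: measurable_funM; [exact: mf|exact: measurable_horner].
  - move: ae_top; apply: filterS; first exact: (ae_filter_ringOfSetsType lambda).
    by move=> t tE Dt; rewrite tE DA.
rewrite (on_piece (derivn r P)); [|exact: measurable_itv|]; last first.
  move=> t /=; rewrite in_itv/= => /andP[t1 tx].
  by rewrite /spline (ltW t1) (le_trans tx (ltW x2)) tx.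
rewrite (on_piece (derivn r Q)); [|exact: measurable_itv|]; last first.
  move=> t /=; rewrite in_itv/= => /andP[xt t1].
  by rewrite /spline t1 (ltW (lt_trans x1 xt)) leNgt xt.
rewrite !sobolev0_by_parts ?(ltW x1) ?(ltW x2)//.
have end1 A : parts_sum r f A r 1 = 0 by apply: parts_sum_end => //; right.
have endN1 A : parts_sum r f A r (-1) = 0 by apply: parts_sum_end => //; left.
rewrite end1 endN1.
rewrite subr0 sub0r -sumrB.
have sr : (s < r)%N by rewrite /r; lia.
have term (j : 'I_r) : (derive1n (r - j.+1) f) x * ((-1) ^+ j *: derivn j (derivn r P)).[x] -
    (derive1n (r - j.+1) f) x * ((-1) ^+ j *: derivn j (derivn r Q)).[x] =
    (derive1n (r - j.+1) f) x * (j == s :> nat)%:R.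
  rewrite !hornerZ -mulrBr -mulrBr -hornerN -hornerD -derivnB.
  have -> : derivn r P - derivn r Q = taylor_ker x s.
    by rewrite -derivnB PQ derivnZ addnC derivn_taylor_ker scalerA -exprD addnn -signr_odd odd_double scale1r.
  congr (_ * _); have [sj|js] := ltnP s j.
    rewrite (_ : derivn j _ = 0) ?horner0 ?mulr0 ?gtn_eqF//.
    apply/polyP => i; rewrite coef_derivn coef0.
    have /leq_sizeP -> := size_taylor_ker x s; first by rewrite mul0rn.
    by rewrite (leq_trans sj)// leq_addr.
  rewrite -{1}(subnKC js) derivn_taylor_ker hornerZ mulrA -exprD addnn -signr_odd odd_double mul1r taylor_ker_atE.
  by rewrite subn_eq0 eqn_leq js.
rewrite (eq_bigr _ (fun j _ => term j)) (bigD1 (Ordinal sr))//= eqxx mulr1 big1 ?addr0.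
  by congr (derive1n _ _ _); rewrite /r; lia.
move=> j js; rewrite (_ : (j == s :> nat) = false) ?mulr0//.
by apply: contraNF js => /eqP js; apply/eqP/val_inj.
Qed.
End representation.
End Pairing.

(** * Minimizers *)

Section Extremals.
Context {R : realType}.
Notation lambda := (@lebesgue_measure R).
Notation mu := (mu11 R).
Notation L2 := (Lfun mu 2%:E).
Implicit Types (f g : R -> R) (p P Q : {poly R}) (x y : R).

Lemma ac_within_continuous (a b : R) (F : R -> R) : absolutely_continuous a b F ->
  {within `[a, b], continuous F}.
Proof.
move=> acF; apply/subspace_continuousP => x /=; rewrite in_itv/= => /andP[ax xb].
apply/cvgrPdist_lt => e e0; have [d d0 Hd] := ac_uniform acF e0.
near=> y.
have : y \in `[a, b]%R by near: y; exact: withinT.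
rewrite in_itv/= => /andP[ay yb].
have xyd : `|x - y| < d by near: y; apply: cvg_within; exact: (nbhsx_ballx x _ d0).
have [xy|/ltW yx] := leP x y.
  by rewrite distrC Hd// (le_lt_trans _ xyd)// distrC ler_norm.
by rewrite Hd// (le_lt_trans _ xyd)// ler_norm.
Unshelve. all: by end_near. Qed.

Section fixed_order.
Variables s k : nat.
Let r := (s + k).+1.
Let N : {poly R} := extremal_value s k.

Let kr : (k < r)%N. Proof. by rewrite /r; lia. Qed.

Definition sup_norm f : R := fine ('N[mu]_+oo [EFin \o derive1n k f])%E.

Lemma sup_norm_le f (C : R) : 0 <= C ->
  (forall x, -1 <= x <= 1 -> `|derive1n k f x| <= C) -> sup_norm f <= C.
Proof.
move=> C0 fC; have NC := mu11_sup_le fC.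
rewrite /sup_norm -lee_fin fineK//.
by rewrite ge0_fin_numE ?Lnorm_ge0// (le_lt_trans NC)// ltry.
Qed.

Lemma le_sup_norm f x : sobolev0 r f -> -1 <= x <= 1 -> `|derive1n k f x| <= sup_norm f.
Proof.
move=> [_ _ acf _ _]; have N11 : -1 <= 1 :> R by lra.
have [C C0 fC] := ac_bounded N11 (acf k kr).
by apply: mu11_le_sup; [exact: acf|exact: le_lt_trans (mu11_sup_le fC) (ltry _)].
Qed.

(** Each derivative of lower order is constant and vanishes at -1. *)
Lemma sobolev0_eq0 f : sobolev0 r f ->
  (forall x, -1 <= x <= 1 -> derive1n k f x = 0) -> f = cst 0.
Proof.
move=> [f_out _ acf _ fe] fk0; have N11 : -1 <= 1 :> R by lra.
suff H j : (j <= k)%N -> forall x, -1 <= x <= 1 -> derive1n (k - j) f x = 0.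
  apply/funext => x; have [x11|/negP nx] := boolP (-1 <= x <= 1); last by rewrite f_out//; exact/negP.
  by have := H k (leqnn k) x x11; rewrite subnn derive1n0.
elim: j => [_|j IH jk x /andP[x1 x2]]; first by rewrite subn0.
have kj : (k - j = (k - j.+1).+1)%N by lia.
have kjr : (k - j.+1 < r)%N by rewrite /r; lia.
have Fg : {ae lambda, forall x : R, -1 < x < 1 -> derivable (derive1n (k - j.+1) f) x 1 ->
    derive1 (derive1n (k - j.+1) f) x = cst 0 x}.
  apply: (@filterE _ _ (ae_filter_ringOfSetsType lambda)) => y /andP[y1 y2] _.
  by rewrite -derive1nS -kj (IH (ltnW jk))// (ltW y1) (ltW y2).
have [_] := ac_FTC N11 (acf _ kjr) (measurable_cst _) Fg (lexx _) x1 x2.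
by rewrite (fe _ kjr).1 subr0 /Rintegral integral0.
Qed.

Lemma sup_norm_gt0 f : admissible r f -> 0 < sup_norm f.
Proof.
move=> [fS f0]; rewrite ltNge; apply/negP => fn; apply: f0.
apply: (sobolev0_eq0 fS) => x x11; apply/eqP; rewrite -normr_le0.
exact: le_trans (le_sup_norm fS x11) fn.
Qed.

Lemma derive1n_cst0 j x : derive1n j (cst 0 : R -> R) x = 0.
Proof.
rewrite (_ : derive1n j _ = cst 0)//; elim: j => [|j IH]; first by rewrite derive1n0.
by rewrite derive1nS IH; apply/funext => y; rewrite derive1_cst.
Qed.

Lemma JE f : J r k f = sobolev0_norm r f / sup_norm f.
Proof. by []. Qed.

Local Opaque l2dot extremal_value sobolev0_norm sup_norm derive1n.

(** The polynomial (X^2 - 1)^r (X - x1)^(k+1) (X - x0)^k, extended by zero. *)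
Lemma separating_function (x0 x1 : R) : -1 < x0 < 1 -> -1 < x1 < 1 -> x0 != x1 ->
  exists T, [/\ sobolev0 r T, derive1n k T x0 != 0 & derive1n k T x1 = 0].
Proof.
move=> x011 x111 x01.
pose A : {poly R} := ('X^2 - 1) ^+ r * ('X - x1%:P) ^+ k.+1.
pose T : {poly R} := ('X - x0%:P) ^+ k * A.
have T1 j : (j < r)%N -> (derivn j T).[1] = 0.
  pose B : {poly R} := ('X + 1) ^+ r * ('X - x1%:P) ^+ k.+1 * ('X - x0%:P) ^+ k.
  have -> : T = ('X - 1%:P) ^+ r * B.
    rewrite /T /A (_ : 'X^2 - 1 = ('X - 1%:P) * ('X + 1)); last by rewrite polyC1; ring.
    by rewrite exprMn /B; ring.
  exact: (derivn_XsubC_exp 1 r B).1.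
have TN1 j : (j < r)%N -> (derivn j T).[-1] = 0.
  pose B : {poly R} := ('X - 1) ^+ r * ('X - x1%:P) ^+ k.+1 * ('X - x0%:P) ^+ k.
  have -> : T = ('X - (-1)%:P) ^+ r * B.
    rewrite /T /A (_ : 'X^2 - 1 = ('X - (-1)%:P) * ('X - 1)); last by rewrite polyCN polyC1; ring.
    by rewrite exprMn /B; ring.
  exact: (derivn_XsubC_exp (-1) r B).1.
have z11 : -1 < (0 : R) < 1 by apply/andP; split; lra.
have TT j : (j < r)%N -> (derivn j T).[0] = (derivn j T).[0] by [].
have TE x : -1 < x < 1 -> derive1n k (spline 0 T T) x = (derivn k T).[x].
  move=> /andP[y1 y2]; rewrite (@derive1n_spline R r 0 T T z11 TN1 T1 TT k kr).
  by rewrite /spline (ltW y1) (ltW y2); case: ifP.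
exists (spline 0 T T); split.
- exact: (@spline_sobolev0 R r 0 T T z11 isT TN1 T1 TT).
- rewrite TE// (derivn_XsubC_exp x0 k A).2 mulf_neq0//.
  rewrite /A hornerM !horner_exp; apply: mulf_neq0; apply: expf_neq0.
    move: x011 => /andP[y1 y2].
    rewrite (_ : _.[_] = x0 ^+ 2 - 1); last by rewrite !hornerE.
    by rewrite lt_eqF// subr_lt0; nra.
  by rewrite hornerXsubC subr_eq0.
- rewrite TE// /T /A mulrA [_ * (_ ^+ k.+1)]mulrC.
  by apply: (derivn_XsubC_exp x1 k.+1 _).1.
Qed.

Lemma green_function x : -1 < x < 1 -> exists g,
  [/\ sobolev0 r g, forall f, sobolev0 r f -> l2dot (derive1n r f) (derive1n r g) = derive1n k f x
    & l2dot (derive1n r g) (derive1n r g) = N.[x]].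
Proof.
move=> x11; have [P [Q [P1 Q1 PQ [szP szQ] Pk]]] := green_pieces s k x.
have gS : sobolev0 r (spline x P Q) := @green_sobolev0 R s k x P Q x11 P1 Q1 PQ.
have gR : forall f, sobolev0 r f ->
    l2dot (derive1n r f) (derive1n r (spline x P Q)) = derive1n k f x :=
  @green_representation R s k x P Q x11 P1 Q1 PQ szP szQ.
exists (spline x P Q); split => //.
by rewrite (gR _ gS) (@green_at R s k x P Q x11 P1 Q1 PQ) Pk.
Qed.

(** The representer at 0 is determined by the jump of its pieces.  For k even the
    jump is a multiple of the odd power X^(s + r), so replacing P(t) by
    (P(t) + Q(-t)) / 2 and Q(t) by (Q(t) + P(-t)) / 2 preserves it, and the result
    is even. *)
Lemma even_green_function : ~~ odd k -> exists g, [/\ even_on11 g,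
  sobolev0 r g, forall f, sobolev0 r f -> l2dot (derive1n r f) (derive1n r g) = derive1n k f 0
    & l2dot (derive1n r g) (derive1n r g) = N.[0]].
Proof.
move=> ek; have x11 : -1 < (0 : R) < 1 by apply/andP; split; lra.
have [P [Q [P1 Q1 PQ [szP szQ] Pk]]] := green_pieces s k (0 : R).
pose m p := p \Po (- 'X).
have derivn_m j p : derivn j (m p) = (-1) ^+ j *: m (derivn j p).
  elim: j => [|j IH]; first by rewrite !derivn0 scale1r.
  rewrite !derivnS IH derivZ /m deriv_comp derivN derivX mulrN1 exprS mulN1r.
  by rewrite scalerN scaleNr.
have m_at p x : (m p).[x] = p.[- x] by rewrite /m horner_comp hornerN hornerX.
have size_m p : size (m p) = size p.
  by rewrite /m size_comp_poly2// size_polyN size_polyX.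
pose h : R := 2^-1.
pose P' := h *: (P + m Q); pose Q' := h *: (Q + m P).
have P'1 j : (j < r)%N -> (derivn j P').[-1] = 0.
  move=> jr; rewrite derivnZ derivnD derivn_m !hornerE m_at opprK P1// Q1//.
  by rewrite mulr0 addr0 mulr0.
have Q'1 j : (j < r)%N -> (derivn j Q').[1] = 0.
  move=> jr; rewrite derivnZ derivnD derivn_m !hornerE m_at P1// Q1//.
  by rewrite mulr0 addr0 mulr0.
have m_exp n p : m (p ^+ n) = m p ^+ n.
  elim: n => [|n IH]; first by rewrite !expr0 /m -polyC1 comp_polyC.
  by rewrite !exprS -IH /m comp_polyM.
have mPQ : m P - m Q = - (P - Q).
  have -> : m P - m Q = m (P - Q) by rewrite /m comp_polyB.
  have mZ a p : m (a *: p) = a *: m p by rewrite /m comp_polyZ.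
  have -> : m (P - Q) = (-1) ^+ (s + r) *: (P - Q).
    rewrite PQ mZ scalerA mulrC -scalerA; congr (_ *: _).
    rewrite /taylor_ker mZ m_exp scalerA mulrC -scalerA; congr (_ *: _).
    have -> : m (0%:P - 'X) = - (0%:P - 'X).
      by rewrite /m comp_polyB comp_polyC comp_polyX polyC0; ring.
    by rewrite [LHS]exprNn -[RHS]mul_polyC polyC_exp polyCN polyC1.
  rewrite (_ : (-1) ^+ (s + r) = -1); first by rewrite scaleN1r.
  by rewrite -signr_odd (_ : odd _ = true) ?expr1// /r; move: ek; lia.
have P'Q' : P' - Q' = (-1) ^+ r *: taylor_ker 0 (s + r).
  rewrite -PQ /P' /Q' -scalerBr.
  have -> : P + m Q - (Q + m P) = (P - Q) - (m P - m Q) by ring.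
  by rewrite mPQ opprK -mulr2n -scaler_nat scalerA mulVf ?scale1r// pnatr_eq0.
have szP' : (size (derivn r P') <= r)%N.
  rewrite derivnZ derivnD derivn_m (leq_trans (size_scale_leq _ _))//.
  rewrite (leq_trans (size_polyD _ _))// geq_max szP (leq_trans (size_scale_leq _ _))//.
  by rewrite size_m.
have szQ' : (size (derivn r Q') <= r)%N.
  rewrite derivnZ derivnD derivn_m (leq_trans (size_scale_leq _ _))//.
  rewrite (leq_trans (size_polyD _ _))// geq_max szQ (leq_trans (size_scale_leq _ _))//.
  by rewrite size_m.
have P'k : (derivn k P').[0] = N.[0].
  rewrite derivnZ derivnD derivn_m hornerZ hornerD hornerZ m_at oppr0.
  rewrite -(@green_matching_lt R s k 0 P Q PQ k kr) Pk -signr_odd (negbTE ek) mul1r.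
  by rewrite /h; field.
have gS : sobolev0 r (spline 0 P' Q') := @green_sobolev0 R s k 0 P' Q' x11 P'1 Q'1 P'Q'.
have gR : forall f, sobolev0 r f ->
    l2dot (derive1n r f) (derive1n r (spline 0 P' Q')) = derive1n k f 0 :=
  @green_representation R s k 0 P' Q' x11 P'1 Q'1 P'Q' szP' szQ'.
exists (spline 0 P' Q'); split => //; last first.
  by rewrite (gR _ gS) (@green_at R s k 0 P' Q' x11 P'1 Q'1 P'Q').
have P'Q'm t : P'.[- t] = Q'.[t].
  by rewrite /P' /Q' !hornerZ !hornerD !m_at opprK addrC.
move=> t /andP[t1 t2]; rewrite /spline t1 t2 lerN2 t2 lerNl t1 /= oppr_le0.
have [t0|t0|->] := ltgtP t 0.
- by rewrite -P'Q'm opprK.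
- by rewrite P'Q'm.
- by rewrite oppr0.
Qed.

(** The form f |-> f^(k)(x) is not zero on the space. *)
Lemma extremal_value_gt0 x : -1 < x < 1 -> 0 < N.[x].
Proof.
move=> x11; have [g [gS gR gN]] := green_function x11.
have [y y11 yx] : exists2 y : R, -1 < y < 1 & x != y.
  have [x0|x0] := eqVneq x 0; last by exists 0 => //; apply/andP; split; lra.
  by exists (1 / 2); [apply/andP; split; lra|rewrite x0 lt_eqF//; lra].
have [T [TS Tx _]] := separating_function x11 y11 yx.
rewrite lt_neqAle -{2}gN l2dot_ge0 andbT; apply: contra_neq Tx => N0.
have gL : derive1n r g \in L2 by case: gS.
have TL : derive1n r T \in L2 by case: TS.
have := l2dot_CS_val TL gL (gR T TS) gN; rewrite -N0 mulr0 => h.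
by apply/eqP; rewrite -sqrf_eq0 eq_le h sqr_ge0.
Qed.

Lemma derive1n_bound f x : sobolev0 r f -> -1 < x < 1 ->
  derive1n k f x ^+ 2 <= N.[x] * sobolev0_norm r f ^+ 2.
Proof.
move=> fS x11; have [g [gS gR gN]] := green_function x11.
have gL : derive1n r g \in L2 by case: gS.
have fL : derive1n r f \in L2 by case: fS.
have [_ ->] := sobolev0_norm_sqr fL; rewrite mulrC.
exact: (l2dot_CS_val fL gL (gR f fS) gN).
Qed.

Lemma green_admissible g x : -1 < x < 1 -> sobolev0 r g ->
  l2dot (derive1n r g) (derive1n r g) = N.[x] -> admissible r g.
Proof.
move=> x11 gS gN; split => // g0; have := extremal_value_gt0 x11; rewrite -gN g0.
rewrite (_ : derive1n r (cst 0) = cst 0); last by apply/funext => t; rewrite derive1n_cst0.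
by rewrite l2dot0 ltxx.
Qed.

(** The derivative of order k of the representer takes at x the value of its
    squared norm, which bounds its sup norm from below. *)
Lemma J_green g x : -1 < x < 1 -> sobolev0 r g ->
  (forall f, sobolev0 r f -> l2dot (derive1n r f) (derive1n r g) = derive1n k f x) ->
  l2dot (derive1n r g) (derive1n r g) = N.[x] ->
  J r k g * sobolev0_norm r g <= 1.
Proof.
move=> x11 gS gR gN; have gL : derive1n r g \in L2 by case: gS.
have ga := green_admissible x11 gS gN.
have sg : 0 < sup_norm g := sup_norm_gt0 ga.
rewrite JE mulrAC ler_pdivrMr// mul1r -expr2 (sobolev0_norm_sqr gL).2 (gR g gS).
apply: le_trans (ler_norm _) (le_sup_norm gS _).
by case/andP: x11 => y1 y2; rewrite (ltW y1) (ltW y2).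
Qed.

(** The even representer at 0 is a global minimizer, because N is largest at 0. *)
Lemma even_order_minimizer : ~~ odd k ->
  exists f0 : R -> R, even_on11 f0 /\ local_minimizer r k f0.
Proof.
move=> ek; have [g [ge gS gR gN]] := even_green_function ek.
have x11 : -1 < (0 : R) < 1 by apply/andP; split; lra.
have ga := green_admissible x11 gS gN.
have gL : derive1n r g \in L2 by case: gS.
have [n0 nE] := sobolev0_norm_sqr gL.
have {}nE : sobolev0_norm r g ^+ 2 = N.[0] by rewrite nE gN.
have Jg := J_green x11 gS gR gN.
exists g; split => //; split => //; exists 1 => // f fa _.
have [fS f0] := fa; have fL : derive1n r f \in L2 by case: fS.
have [nf0 _] := sobolev0_norm_sqr fL.
have sf := sup_norm_gt0 fa.
have bound x : -1 < x < 1 -> derive1n k f x ^+ 2 <= N.[x] * sobolev0_norm r f ^+ 2.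
  exact: derive1n_bound fS.
move: (JE f) nf0 bound; move: (sobolev0_norm r f) => b -> b0 bound.
move: Jg n0 nE; move: (sobolev0_norm r g) => a Jg a0 aE.
have N0 : 0 < N.[0] := extremal_value_gt0 x11.
have sf_le : sup_norm f <= a * b.
  apply: sup_norm_le (mulr_ge0 a0 b0) _ => x x11'.
  rewrite -ler_sqr ?nnegrE ?mulr_ge0// real_normK ?num_real// exprMn aE.
  have [y11|nx] := boolP (-1 < x < 1).
    by rewrite (le_trans (bound _ y11))// ler_wpM2r ?sqr_ge0// extremal_value_le_at0.
  have -> : derive1n k f x = 0.
    case: fS => _ _ _ _ /(_ _ kr) [fN1 f1].
    move: x11' nx => /andP[]; rewrite le_eqVlt => /predU1P[<-//|->].
    by rewrite le_eqVlt => /predU1P[->//|->].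
  by rewrite expr0n /= mulr_ge0 ?sqr_ge0// ltW.
have ag : 0 < a by rewrite lt_neqAle a0 andbT eq_sym -sqrf_eq0 aE gt_eqF.
rewrite -(ler_pM2r ag) (le_trans Jg)// mulrAC ler_pdivlMr// mul1r mulrC.
exact: sf_le.
Qed.

Lemma parity_derive1n (c : R) f : sobolev0 r f ->
  (forall x, -1 <= x <= 1 -> f (- x) = c * f x) ->
  forall j, (j < r)%N -> forall x, -1 < x < 1 ->
    derive1n j f (- x) = (-1) ^+ j * c * derive1n j f x.
Proof.
move=> [_ df _ _ _] fc; elim=> [_ x /andP[x1 x2]|j IH jr x x11].
  by rewrite !derive1n0 mul1r fc// (ltW x1) (ltW x2).
pose F := derive1n j f.
have /andP[x1 x2] := x11.
have dF y : -1 < y < 1 -> is_derive y 1 F (derive1n j.+1 f y).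
  by move=> /andP[y1 y2]; rewrite derive1nS derive1E; apply: derivableP; apply: df => //; rewrite (ltW y1) (ltW y2).
have dFN : is_derive x 1 (F \o -%R) (- derive1n j.+1 f (- x)).
  have dN : is_derive x 1 (-%R : R -> R) (-1) by exact: is_deriveNid.
  have Nx11 : -1 < - x < 1 by rewrite ltrNl opprK x2 ltrNl x1.
  have dF' := dF (- x) Nx11.
  have D := is_derive1_comp dF' dN.
  by apply: (is_derive_eq D); rewrite mulrN1.
have dcF := is_deriveZ ((-1) ^+ j * c) (dF x x11).
have nearE : \near x, (F \o -%R) x = (((-1) ^+ j * c) *: F) x.
  near=> y; rewrite /F /= (IH (ltnW jr))//.
  apply/andP; split; near: y; [exact: lt_nbhsr|exact: lt_nbhsl].
have := near_eq_derive (1 : R^o) nearE.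
have [_ ->] := dFN; have [_ ->] := dcF; rewrite exprS => E.
by rewrite -[LHS]opprK E /GRing.scale /=; ring.
Unshelve. all: by end_near. Qed.

(** Extremality compared with the representers at y gives N(y) |f|^2 <= M^2 for all
    y, where M is the maximum of |f^(k)|; at x0 and -x0 Cauchy-Schwarz gives the
    converse. *)
Lemma odd_order_no_parity (c : R) f : odd k -> `|c| = 1 -> extremal r k f ->
  ~ (forall x, -1 <= x <= 1 -> f (- x) = c * f x).
Proof.
move=> ok c1 [fa fmin] fc; have [fS f0] := fa.
have fL : derive1n r f \in L2 by case: fS.
have [b0 bE] := sobolev0_norm_sqr fL.
have up y : -1 < y < 1 -> derive1n k f y ^+ 2 <= N.[y] * sobolev0_norm r f ^+ 2.
  by move=> y11; exact: derive1n_bound.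
move: b0 bE (JE f) up; move: (sobolev0_norm r f) => b b0 bE JfE up.
have N11 : -1 <= 1 :> R by lra.
have acf : absolutely_continuous (-1) 1 (derive1n k f) by case: fS => _ _ + _ _; apply.
have [C C0 fC] := ac_bounded N11 acf.
have sf := sup_norm_gt0 fa.
have cnf : {within `[-1, 1], continuous (fun x => `|derive1n k f x|)}.
  by move=> x; apply: continuous_comp; [exact: (ac_within_continuous acf)|exact: norm_continuous].
have [x0 x0in x0max] := EVT_max N11 cnf.
have supE : sup_norm f <= `|derive1n k f x0|.
  by apply: sup_norm_le => // x x11; apply: x0max; rewrite in_itv.
have fx0 : 0 < `|derive1n k f x0| by exact: lt_le_trans sf supE.
have x011 : -1 < x0 < 1.
  case: fS => _ _ _ _ /(_ _ kr) [fN1 f1].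
  move: x0in; rewrite in_itv/= => /andP[]; rewrite !le_eqVlt.
  move=> /predU1P[E|->]; first by move: fx0; rewrite -E fN1 normr0 ltxx.
  by move=> /predU1P[E|->//]; move: fx0; rewrite E f1 normr0 ltxx.
have Nx011 : -1 < - x0 < 1 by move: x011 => /andP[? ?]; apply/andP; split; lra.
have fNx0 : derive1n k f (- x0) ^+ 2 = derive1n k f x0 ^+ 2.
  rewrite (parity_derive1n fS fc kr x011) !exprMn sqrr_sign mul1r.
  by rewrite -[c ^+ 2]real_normK ?num_real// c1 expr1n mul1r.
have low y : -1 < y < 1 -> N.[y] * b ^+ 2 <= derive1n k f x0 ^+ 2.
  move=> y11; have [g [gS gR gN]] := green_function y11.
  have gL : derive1n r g \in L2 by case: gS.
  have [a0 aE] := sobolev0_norm_sqr gL; rewrite gN in aE.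
  have Jg := J_green y11 gS gR gN.
  have := fmin g (green_admissible y11 gS gN); rewrite JfE.
  move: (sobolev0_norm r g) (J r k g) a0 aE Jg => a Jg a0 <- Jg1 Jle.
  have : b / sup_norm f * a <= 1 by rewrite (le_trans _ Jg1)// ler_wpM2r.
  rewrite mulrAC ler_pdivrMr// mul1r => h.
  rewrite -[leRHS]real_normK ?num_real// -exprMn mulrC.
  by rewrite ler_sqr ?nnegrE ?(ltW fx0) ?mulr_ge0// (le_trans h).
have sq0 : 0 < derive1n k f x0 ^+ 2 by rewrite -real_normK ?num_real// exprn_gt0.
have nf2 : 0 < b ^+ 2.
  by have := lt_le_trans sq0 (up _ x011); rewrite pmulr_rgt0// extremal_value_gt0.
have x0N : x0 != - x0.
  apply/eqP => x0E; have x00 : x0 = 0 by lra.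
  have [x1 /andP[x10 x11] N1] := @extremal_value_gt_at0 R s k ok.
  have x1in : -1 < x1 < 1 by rewrite x11 andbT; lra.
  have := le_trans (low x1 x1in) (up _ x011).
  by rewrite ler_pM2r// x00 leNgt N1.
have [T [TS Tx0 TNx0]] := separating_function x011 Nx011 x0N.
have TL : derive1n r T \in L2 by case: TS.
have eqCS y : -1 < y < 1 -> derive1n k f y ^+ 2 = derive1n k f x0 ^+ 2 ->
    N.[y] * l2dot (derive1n r f) (derive1n r T) = derive1n k f y * derive1n k T y.
  move=> y11 fy; have [g [gS gR gN]] := green_function y11.
  have gL : derive1n r g \in L2 by case: gS.
  apply: (l2dot_CS_eq_val fL gL TL (gR f fS) (gR T TS) gN).
  by rewrite -bE mulrC; apply/eqP; rewrite eq_le up// fy low.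
have := eqCS _ Nx011 fNx0; rewrite TNx0 mulr0 => /eqP.
rewrite mulf_eq0 gt_eqF ?extremal_value_gt0//= => /eqP l2dot0.
have := eqCS _ x011 erefl; rewrite l2dot0 mulr0 => /esym/eqP.
by rewrite mulf_eq0 (negbTE Tx0) orbF -normr_eq0 gt_eqF.
Qed.

End fixed_order.
End Extremals.

Theorem theorem1 (R : realType) (r k : nat) (hkr : (k < r)%N) :
  (odd k -> forall f : R -> R, extremal r k f -> asymmetrical f) /\
  (~~ odd k -> exists f0 : R -> R, even_on11 f0 /\ local_minimizer r k f0).
Proof.
have [s rE] : exists s, r = (s + k).+1 by exists (r - k.+1)%N; lia.
rewrite rE; split; last exact: even_order_minimizer.
move=> ok f fE; split=> par.
- by apply: (odd_order_no_parity (c := 1) ok _ fE); rewrite ?normr1// => x x11; rewrite mul1r par.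
- by apply: (odd_order_no_parity (c := -1) ok _ fE); rewrite ?normrN1// => x x11; rewrite mulN1r par.
Qed.
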